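(* There exists an absolute constant $C$ such that for every $n\ge 2$ and every hyperplane $H=\theta^\perp\subset\mathbb R^n$ ($\theta\in S^{n-1}$), if $X$ is a random vector uniformly distributed on $P_HB_1^n$, then $$\operatorname{Var}|X|^2\le C\,\lambda_X^2\,\mathbb E|X|^2 .$$
   Context: $B_1^n=\{x\in\mathbb R^n:\sum_{i=1}^n|x_i|\le 1\}$ is the unit ball of $\ell_1^n$, $P_H$ is the orthogonal projection onto $H$, $|\cdot|$ is the Euclidean norm, and ''uniformly distributed'' refers to $(n-1)$-dimensional Lebesgue measure on $H$. $\lambda_X^2=\sup_{\xi}\mathbb E\langle X,\xi\rangle^2$, the supremum being over Euclidean unit vectors $\xi\in H$ (this is the largest eigenvalue of the covariance matrix of $X$). ''Absolute constant'' means a positive number independent of $n$ and $H$. *)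

(* Defs.v *)
From HB Require Import structures.
From mathcomp Require Import all_boot all_order all_algebra.
From mathcomp Require Import all_classical all_reals all_analysis.

Set Implicit Arguments.
Unset Strict Implicit.
Unset Printing Implicit Defensive.

Import Order.TTheory GRing.Theory Num.Theory.
Import numFieldNormedType.Exports.

Local Open Scope classical_set_scope.
Local Open Scope ring_scope.

Section row_vector_measurable.
Context d (T : measurableType d) (n : nat).

Let coord (i : 'I_n) (x : 'rV[T]_n) : T := x ord0 i.

Let rV_set0 : g_sigma_preimage coord set0.
Proof. exact: sigma_algebra0. Qed.

Let rV_setC A : g_sigma_preimage coord A -> g_sigma_preimage coord (~` A).
Proof. exact: sigma_algebraC. Qed.

Let rV_bigcup (F : (set _)^nat) : (forall i, g_sigma_preimage coord (F i)) ->
  g_sigma_preimage coord (\bigcup_i (F i)).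
Proof. exact: sigma_algebra_bigcup. Qed.

(* The product sigma-algebra (for T = R, the Borel sets of R^n); same
   construction and display as the library's instance on n.-tuple T. *)
HB.instance Definition _ := @isMeasurable.Build (measure_tuple_display d)
  'rV[T]_n (g_sigma_preimage coord) rV_set0 rV_setC rV_bigcup.

End row_vector_measurable.

Section row_vector_measurable_theory.
Context d (T : measurableType d).

Lemma measurable_coord n (i : 'I_n) :
  measurable_fun setT (fun x : 'rV[T]_n => x ord0 i).
Proof.
move=> _ A mA; apply: sub_sigma_algebra.
case: n i => [[] []//|n i].
rewrite -bigcup_mkord_ord; exists i; first exact: ltn_ord.
by exists A => //; rewrite inord_val.
Qed.

Lemma measurable_fun_rowP d' (T' : measurableType d') n (f : T' -> 'rV[T]_n) :
  measurable_fun setT f <->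
  forall i, measurable_fun setT (fun x => f x ord0 i).
Proof.
split=> [mf i|mf].
  by apply: (measurableT_comp (f := fun x : 'rV[T]_n => x ord0 i)) mf;
    exact: measurable_coord.
apply: (measurability (\big[setU/set0]_(i < n)
  preimage_set_system setT (fun x : 'rV[T]_n => x ord0 i) measurable)) => //.
case: n => [|n] in f mf *; first by rewrite big_ord0 => A [B []].
rewrite -bigcup_mkord_ord => A [B [i ilt [C mC <-]] <-].
have := mf (inord i) measurableT C mC.
by rewrite !setTI.
Qed.

End row_vector_measurable_theory.

Section lebesgue_rV.
Context {R : realType}.

Definition cons_rV m (p : R * 'rV[R]_m) : 'rV[R]_m.+1 := row_mx p.1%:M p.2.

Lemma cons_rV0 m (p : R * 'rV[R]_m) : cons_rV p ord0 ord0 = p.1.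
Proof.
have -> : ord0 = lshift m ord0 :> 'I_(1 + m) by exact: val_inj.
by apply: etrans (row_mxEl _ _ _ _) _; rewrite mxE.
Qed.

Lemma cons_rVS m (p : R * 'rV[R]_m) (i : 'I_m) :
  cons_rV p ord0 (lift ord0 i) = p.2 ord0 i.
Proof.
have -> : lift ord0 i = rshift 1 i :> 'I_(1 + m) by exact: val_inj.
exact: row_mxEr.
Qed.

Lemma measurable_cons_rV m : measurable_fun setT (@cons_rV m).
Proof.
apply/measurable_fun_rowP => i; case: (unliftP ord0 i) => [j|] ->.
  under eq_fun do rewrite cons_rVS.
  by apply: (measurableT_comp (f := fun x : 'rV[R]_m => x ord0 j));
    [exact: measurable_coord|exact: measurable_snd].
by under eq_fun do rewrite cons_rV0; exact: measurable_fst.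
Qed.

Definition uncons_rV m (v : 'rV[R]_m.+1) : R * 'rV[R]_m :=
  (v ord0 ord0, \row_j v ord0 (lift ord0 j)).

Lemma measurable_uncons_rV m : measurable_fun setT (@uncons_rV m).
Proof.
apply/measurable_fun_pairP; split; first exact: measurable_coord.
apply/measurable_fun_rowP => i.
by under eq_fun do rewrite mxE; exact: measurable_coord.
Qed.

Lemma cons_rVK m : cancel (@cons_rV m) (@uncons_rV m).
Proof.
move=> [x v]; rewrite /uncons_rV cons_rV0; congr (_, _).
by apply/rowP => j; rewrite mxE cons_rVS.
Qed.

Lemma uncons_rVK m : cancel (@uncons_rV m) (@cons_rV m).
Proof.
move=> v; apply/rowP => i; case: (unliftP ord0 i) => [j|] ->.
  by rewrite cons_rVS mxE.
by rewrite cons_rV0.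
Qed.

Section lebesgue_step.
Variables (m : nat) (mu : {sigma_finite_measure set 'rV[R]_m -> \bar R}).

Definition lebesgue_rV_step : set 'rV[R]_m.+1 -> \bar R :=
  pushforward (lebesgue_measure \x mu)%E (@cons_rV m).

Let mstep A : measurable A -> measurable (@cons_rV m @^-1` A).
Proof. by move=> mA; rewrite -[X in measurable X]setTI; exact: measurable_cons_rV. Qed.

Let step0 : lebesgue_rV_step set0 = 0%E.
Proof. by rewrite /lebesgue_rV_step /pushforward preimage_set0 measure0. Qed.

Let step_ge0 A : (0 <= lebesgue_rV_step A)%E.
Proof. exact: (measure_ge0 (lebesgue_measure \x mu)%E). Qed.

Let step_sigma_additive : semi_sigma_additive lebesgue_rV_step.
Proof.
move=> F mF tF mUF; rewrite /lebesgue_rV_step /pushforward preimage_bigcup.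
apply: measure_semi_sigma_additive.
- by move=> k; exact: mstep.
- apply/trivIsetP => /= i j _ _ ij; rewrite -preimage_setI.
  by move/trivIsetP : tF => /(_ _ _ _ _ ij) ->//; rewrite preimage_set0.
- by rewrite -preimage_bigcup; exact: mstep.
Qed.

HB.instance Definition _ := isMeasure.Build _ _ _ lebesgue_rV_step
  step0 step_ge0 step_sigma_additive.

Let step_sigma_finite : sigma_finite setT lebesgue_rV_step.
Proof.
have /sigma_finiteP[F [TF ndF Foo]] := sigma_finiteT (@lebesgue_measure R).
have /sigma_finiteP[G [TG ndG Goo]] := sigma_finiteT mu.
exists (fun k => @uncons_rV m @^-1` (F k `*` G k)).
  apply/esym; rewrite -subTset => v _.
  have [i _ Fi] : (\bigcup_i F i) (v ord0 ord0) by rewrite -TF.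
  have [j _ Gj] : (\bigcup_i G i) (uncons_rV v).2 by rewrite -TG.
  exists (maxn i j) => //; split.
    by move: Fi; exact/subsetPset/ndF/leq_maxl.
  by move: Gj; exact/subsetPset/ndG/leq_maxr.
move=> k; have [mF Fk] := Foo k; have [mG Gk] := Goo k; split.
  by rewrite -[X in measurable X]setTI; apply: measurable_uncons_rV => //;
    exact: measurableX.
rewrite /lebesgue_rV_step /pushforward -comp_preimage.
rewrite (_ : _ \o _ = id); last by apply/funext => p /=; rewrite cons_rVK.
by rewrite preimage_id product_measure1E// lte_mul_pinfty// ge0_fin_numE.
Qed.

HB.instance Definition _ := Measure_isSigmaFinite.Build _ _ _ lebesgue_rV_step
  step_sigma_finite.

End lebesgue_step.

(* The m-dimensional Lebesgue measure on R^m, as an iterated product. *)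
Fixpoint lebesgue_rV m : {sigma_finite_measure set 'rV[R]_m -> \bar R} :=
  if m is k.+1 then lebesgue_rV_step (lebesgue_rV k) else @dirac _ 'rV[R]_0 0 R.

Lemma measurable_box m (A : 'I_m -> set R) : (forall i, measurable (A i)) ->
  measurable [set v : 'rV[R]_m | forall i, A i (v ord0 i)].
Proof.
move=> mA.
rewrite (_ : mkset _ =
    \bigcap_(i in [set: 'I_m]) ((fun v : 'rV[R]_m => v ord0 i) @^-1` A i)).
  apply: fin_bigcap_measurable => // i _.
  by rewrite -[X in measurable X]setTI; exact: measurable_coord.
by apply/seteqP; split=> [v Av i _|v Av i]; [exact: Av|exact: (Av i I)].
Qed.

Lemma lebesgue_rV_box m (A : 'I_m -> set R) : (forall i, measurable (A i)) ->
  lebesgue_rV m [set v : 'rV[R]_m | forall i, A i (v ord0 i)] =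
  (\prod_(i < m) lebesgue_measure (A i))%E.
Proof.
elim: m A => [|m IHm] A mA /=.
  by rewrite big_ord0 /= diracE mem_set// => -[].
have mB := measurable_box (fun i : 'I_m => mA (lift ord0 i)).
rewrite big_ord_recl -IHm; last by move=> i; exact: mA.
rewrite -(product_measure1E (@lebesgue_measure R) (lebesgue_rV m) (mA ord0) mB).
rewrite /lebesgue_rV_step /pushforward; congr (_ _).
apply/seteqP; split=> [[x v] /= Axv|[x v] /= [Ax Av] i].
  split=> /=; first by have := Axv ord0; rewrite cons_rV0.
  by move=> i; have := Axv (lift ord0 i); rewrite cons_rVS.
by case: (unliftP ord0 i) => [j|] ->; rewrite ?cons_rVS ?cons_rV0//; exact: Av.
Qed.

End lebesgue_rV.

Section euclidean.
Context {R : realType}.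

Definition dotv n (x y : 'rV[R]_n) : R := \sum_(i < n) x ord0 i * y ord0 i.

Definition enorm n (x : 'rV[R]_n) : R := Num.sqrt (dotv x x).

Definition l1_ball n : set 'rV[R]_n :=
  [set x | \sum_(i < n) `|x ord0 i| <= 1].

Definition hyperplane n (theta : 'rV[R]_n) : set 'rV[R]_n :=
  [set x | dotv x theta = 0].

(* Meaningful for enorm theta = 1 only, see orth_projP. *)
Definition orth_proj n (theta x : 'rV[R]_n) : 'rV[R]_n :=
  x - dotv x theta *: theta.

Lemma orth_projP n (theta x : 'rV[R]_n) : enorm theta = 1 ->
  hyperplane theta (orth_proj theta x) /\
  forall y, hyperplane theta y -> dotv (x - orth_proj theta x) y = 0.
Proof.
move=> theta1.
have dot1 : dotv theta theta = 1.
  have dot_ge0 : 0 <= dotv theta theta by apply: sumr_ge0 => i _; exact: sqr_ge0.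
  by rewrite -(sqr_sqrtr dot_ge0) -/(enorm theta) theta1 expr1n.
rewrite /hyperplane /orth_proj /=; split.
  rewrite {1}/dotv; under eq_bigr do rewrite !mxE mulrBl -mulrA.
  by rewrite sumrB -mulr_sumr -/(dotv x theta) -/(dotv theta theta) dot1 mulr1 subrr.
move=> y y0; rewrite subKr /dotv; under eq_bigr do rewrite !mxE -mulrA.
rewrite -mulr_sumr; under [X in _ * X]eq_bigr do rewrite mulrC.
by rewrite -/(dotv y theta) y0 mulr0.
Qed.

(* The rows of U form an orthonormal basis of H, i.e. v |-> v *m U is a linear
   isometry of R^m onto H. *)
Definition orthonormal_basis m n (H : set 'rV[R]_n) (U : 'M[R]_(m, n)) : Prop :=
  U *m U^T = 1%:M /\ range (fun v : 'rV[R]_m => v *m U) = H.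

(* The m-dimensional Lebesgue measure on the row space of U, when U has
   orthonormal rows. *)
Definition subspace_lebesgue m n (U : 'M[R]_(m, n)) : set 'rV[R]_n -> \bar R :=
  pushforward (lebesgue_rV m) (fun v : 'rV[R]_m => v *m U).

End euclidean.

Section random_vector.
Context d (T : measurableType d) (R : realType) (P : probability T R) (n : nat).
Local Open Scope ereal_scope.

(* X is uniformly distributed on K with respect to (n-1)-dimensional Lebesgue
   measure on the hyperplane H; by rotation invariance that measure does not
   depend on the orthonormal basis U used to identify H with R^(n-1). *)
Definition uniform_in_hyperplane (H K : set 'rV[R]_n)
    (X : {RV P >-> 'rV[R]_n}) : Prop :=
  exists2 U : 'M[R]_(n.-1, n), orthonormal_basis H U &
    forall A, measurable A ->
      distribution P X A = subspace_lebesgue U (A `&` K) / subspace_lebesgue U K.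

Definition lambda_sqr (H : set 'rV[R]_n) (X : {RV P >-> 'rV[R]_n}) : \bar R :=
  ereal_sup [set 'E_P[fun w => (dotv (X w) xi ^+ 2)%R] |
             xi in [set xi | H xi /\ enorm xi = 1%R]].

End random_vector.

Arguments l1_ball {R} n.
Arguments uniform_in_hyperplane {d T R} P {n}.
Arguments lambda_sqr {d T R} P {n}.

(* Main.v *)
Require Import Defs.
From mathcomp Require Import all_boot all_order all_algebra all_fingroup.
From mathcomp Require Import all_classical all_reals all_analysis.
From mathcomp Require Import measurable_realfun ring lra.

Set Implicit Arguments.
Unset Strict Implicit.
Unset Printing Implicit Defensive.

Import Order.TTheory GRing.Theory Num.Theory.
Import numFieldNormedType.Exports.

Local Open Scope classical_set_scope.
Local Open Scope ring_scope.

(** Let H be the hyperplane orthogonal to the unit vector th, s(x) = <sgn x, th>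
    and, for h in H, m(h) = min_t |h + t th|_1, so that P_H B_1^n = {m <= 1}.
    On the line h + R th the convex piecewise affine function t |-> |h + t th|_1
    has slope s, hence the integral of s_+ e^(-|.|_1) over that line is e^(-m(h)).
    Integrating in h and slicing by the level sets of m gives, for g >= 0
    homogeneous of degree d and up to a constant independent of g and d,
      int_{R^n} g(P_H x) s_+(x) e^(-|x|_1) dx = (n-1+d)! int_{P_H B_1^n} g.
    Split over the orthants, the left-hand side is an average over signs e, with
    weights <e, th>_+, and over independent standard exponential variables y_i,
    of g(P_H(e y)), where |P_H(e y)|^2 = |y|^2 - <e y, th>^2.  For |X|^2 and |X|^4
    this only needs the moments of the y_i and Khintchine-type bounds for signs:
    E|X|^2 is of order 1/n and Var|X|^2 = O(1/n^3), while summing over an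
    orthonormal basis of H gives lambda^2 >= E|X|^2 / (n-1). *)

(** * Linear changes of variables *)

(** The weight s_+ is chosen because, wherever it is positive, s_+ e^(-|.|_1) is minus the
    derivative of e^(-|.|_1) along the line, so that the integral sees only the minimum of the norm.
    This trades the dependent coordinates of X for independent exponentials, whatever th is.

    The difficulty is a cancellation. With N = n, both N (N + 1) E|X|^2 and N (N + 1) (N + 2) (N +
    3) E|X|^4 are weighted averages over signs, with leading terms 2 N and 4 N^2; the leading terms
    cancel in the variance, so each average must be known up to a relative error O(1/N). One-sided
    estimates suffice: 2 N - O(1) from below and 4 N^2 + O(N) from above. The terms in <e y, th> are
    of lower order uniformly in th, provided the total weight is at least a fixed multiple of 2^n;
    that is where a lower Khintchine bound enters. No eigenvalue of the covariance is estimated: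
    lambda^2 is only compared with the mean of the eigenvalues. *)

Section lebesgue_rV_integral.
Context {R : realType}.
Notation mu := (@lebesgue_measure R).

Lemma measurable_affine (a b : R) :
  measurable_fun [set: R] (fun x => a * x + b).
Proof. by apply: measurable_funD => //; exact: measurable_funM. Qed.

(** Lebesgue measure is determined by its values on the intervals []x, y]]. For [a < 0] the preimage
    is closed at the other end, which does not affect its length. *)
Lemma lebesgue_measure_affine (a b : R) (A : set R) : a != 0 -> measurable A ->
  mu A = (`|a|%:E * mu ((fun x => a * x + b)%R @^-1` A))%E.
Proof.
move=> a0 mA.
pose phi (x : measurableTypeR R) : measurableTypeR R := a * x + b.
have mphi : measurable_fun [set: measurableTypeR R] phi := measurable_affine a b.
pose nu := mscale (NngNum (normr_ge0 a)) (pushforward mu phi).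
rewrite (_ : (_ * _)%E = nu mphi A)//.
apply: lebesgue_measure_unique => //= _ [[x y]] _ <-.
rewrite /nu /mscale /= /pushforward /phi.
have [agt0|alt0|/eqP] := ltgtP 0 a; last by rewrite eq_sym (negPf a0).
- rewrite (_ : _ @^-1` _ = `](x - b) / a, (y - b) / a]%classic); last first.
    by apply/seteqP; split => z /=; rewrite !in_itv/= ltr_pdivrMr// ler_pdivlMr//
      ltrBlDr lerBrDr mulrC.
  rewrite !lebesgue_measure_itv/= !lte_fin ltr_pM2r ?invr_gt0// ltrD2r.
  case: ifPn => xy; last by rewrite mule0.
  rewrite -!EFinB -EFinM gtr0_norm//; congr EFin.
  rewrite -mulrBl opprB addrA subrK mulrC divfK//.
- rewrite (_ : _ @^-1` _ = `[(y - b) / a, (x - b) / a[%classic); last first.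
    apply/seteqP; split => z /=; rewrite !in_itv/= ler_ndivrMr// ltr_ndivlMr//
      ltrBlDr lerBrDr mulrC => /andP[-> ->] //.
  rewrite !lebesgue_measure_itv/= !lte_fin ltr_nM2r ?invr_lt0// ltrD2r.
  case: ifPn => xy; last by rewrite mule0.
  rewrite -!EFinB -EFinM ltr0_norm//; congr EFin.
  by rewrite -mulrBl opprB addrA subrK mulrC mulrN divfK// opprB.
Qed.

Lemma ge0_integral_affine (a b : R) (f : R -> \bar R) : a != 0 ->
  measurable_fun [set: R] f -> (forall x, 0 <= f x)%E ->
  (\int[mu]_x f (a * x + b)%R = `|a|^-1%:E * \int[mu]_x f x)%E.
Proof.
move=> a0 mf f0.
pose phi (x : measurableTypeR R) : measurableTypeR R := a * x + b.
have mphi : measurable_fun [set: measurableTypeR R] phi := measurable_affine a b.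
have ia_ge0 : 0 <= `|a|^-1 by rewrite invr_ge0.
rewrite -[RHS](@ge0_integral_mscale _ _ _ mu _ _ (NngNum ia_ge0))//.
transitivity (\int[pushforward mu phi]_x f x)%E.
  by rewrite (ge0_integral_pushforward mphi).
apply: eq_measure_integral => A mA _.
change (pushforward mu phi A = `|a|^-1%:E * mu A)%E.
rewrite (lebesgue_measure_affine b a0 mA) muleA -EFinM mulVf ?mul1e//.
by rewrite normr_eq0.
Qed.

Lemma measurable_fun_cons_rV d (T : measurableType d) m (g : T -> R) (h : T -> 'rV[R]_m) :
  measurable_fun setT g -> measurable_fun setT h ->
  measurable_fun setT (fun x => cons_rV (g x, h x)).
Proof.
move=> mg mh; apply: (measurableT_comp (@measurable_cons_rV R m)).
exact/measurable_fun_pairP.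
Qed.

Section fubini.
Variables (m : nat) (f : 'rV[R]_m.+1 -> \bar R).
Hypothesis mf : measurable_fun setT f.
Hypothesis f0 : forall v, (0 <= f v)%E.

Let fc (p : measurableTypeR R * 'rV[R]_m) : \bar R := f (cons_rV p).

Let mfc : measurable_fun setT fc.
Proof. exact: (measurableT_comp mf (@measurable_cons_rV R m)). Qed.

Let fc0 p : (0 <= fc p)%E.
Proof. exact: f0. Qed.

Lemma integral_lebesgue_rVS_prod :
  (\int[lebesgue_rV m.+1]_v f v =
   \int[mu \x lebesgue_rV m]_p f (cons_rV p))%E.
Proof.
rewrite -(@ge0_integral_pushforward _ _ (measurableTypeR R * 'rV[R]_m)%type
  'rV[R]_m.+1 R (@cons_rV R m) (@measurable_cons_rV R m)
  (mu \x lebesgue_rV m)%E setT f)//.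
Qed.

Lemma integral_lebesgue_rVS :
  (\int[lebesgue_rV m.+1]_v f v =
   \int[mu]_x \int[lebesgue_rV m]_v f (cons_rV (x, v)))%E.
Proof.
rewrite integral_lebesgue_rVS_prod.
by rewrite (fubini_tonelli1 (m1 := mu) (m2 := lebesgue_rV m) fc mfc fc0).
Qed.

(** The order with the first coordinate innermost serves for lower triangular matrices and, in a
    basis starting with [th], for integrating along the lines parallel to [th]. *)
Lemma integral_lebesgue_rVSr :
  (\int[lebesgue_rV m.+1]_v f v =
   \int[lebesgue_rV m]_v \int[mu]_x f (cons_rV (x, v)))%E.
Proof.
rewrite integral_lebesgue_rVS_prod.
by rewrite (fubini_tonelli2 (m1 := mu) (m2 := lebesgue_rV m) fc mfc fc0).
Qed.

Lemma measurable_integral_rVS :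
  measurable_fun [set: R] (fun x => \int[lebesgue_rV m]_v f (cons_rV (x, v)))%E.
Proof. exact: (measurable_fun_fubini_tonelli_F (m2 := lebesgue_rV m) fc mfc fc0). Qed.

Lemma measurable_integral_rVSr :
  measurable_fun setT (fun v => \int[mu]_x f (cons_rV (x, v)))%E.
Proof. exact: (measurable_fun_fubini_tonelli_G (m1 := mu) fc mfc fc0). Qed.

End fubini.

Lemma measurable_mulmx m n (M : 'M[R]_(m, n)) :
  measurable_fun setT (fun v : 'rV[R]_m => v *m M).
Proof.
apply/measurable_fun_rowP => j.
under eq_fun do rewrite mxE.
apply: measurable_sum => i; apply: measurable_funM => //.
exact: measurable_coord.
Qed.

Lemma measurable_addmx d (T : measurableType d) n (f g : T -> 'rV[R]_n) :
  measurable_fun setT f -> measurable_fun setT g ->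
  measurable_fun setT (fun v => f v + g v).
Proof.
move=> /measurable_fun_rowP mf /measurable_fun_rowP mg; apply/measurable_fun_rowP => j.
by under eq_fun do rewrite mxE; exact: measurable_funD.
Qed.

Lemma cons_rV_mulmx m (x : R) (v : 'rV[R]_m) (M : 'M[R]_m.+1) (w : 'rV[R]_m.+1) :
  cons_rV (x, v) *m M + w =
  cons_rV (x * M ord0 ord0 + (v *m (\col_i M (lift ord0 i) ord0)) ord0 ord0
     + w ord0 ord0,
   x *: (\row_j M ord0 (lift ord0 j))
     + v *m (\matrix_(i, j) M (lift ord0 i) (lift ord0 j)) + \row_j w ord0 (lift ord0 j)).
Proof.
apply/rowP => j; rewrite mxE mxE big_ord_recl cons_rV0.
under eq_bigr do rewrite cons_rVS.
case: (unliftP ord0 j) => [k|] ->; rewrite ?cons_rVS ?cons_rV0 ?mxE//=.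
  by congr (_ + _ + _); apply: eq_bigr => i _; rewrite mxE.
by congr (_ + _ + _); apply: eq_bigr => i _; rewrite mxE.
Qed.

(** The first coordinate of [v *m M] depends on that of [v] alone. With it fixed, it only shifts the
    remaining coordinates; the translation [w] is there to absorb this shift in the induction. *)
Lemma ge0_integral_upper_triangular n (M : 'M[R]_n) (w : 'rV[R]_n)
    (f : 'rV[R]_n -> \bar R) :
  (forall i j : 'I_n, (j < i)%N -> M i j = 0) -> (forall i, M i i != 0) ->
  measurable_fun setT f -> (forall v, 0 <= f v)%E ->
  (\int[lebesgue_rV n]_v f (v *m M + w)%R =
   (\prod_i `|M i i|^-1)%:E * \int[lebesgue_rV n]_v f v)%E.
Proof.
elim: n M w f => [|n IH] M w f tM dM mf f0.
  rewrite big_ord0 mul1e; apply: eq_integral => v _.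
  by congr f; apply/rowP => -[].
have mfM : measurable_fun setT (fun v : 'rV[R]_n.+1 => f (v *m M + w)).
  apply: (measurableT_comp mf); apply: measurable_addmx => //.
  exact: measurable_mulmx.
rewrite integral_lebesgue_rVS//.
set b := \row_j M ord0 (lift ord0 j).
set M' := \matrix_(i, j) M (lift ord0 i) (lift ord0 j).
set w' := \row_j w ord0 (lift ord0 j).
set K := \prod_i `|M' i i|^-1.
have K0 : 0 <= K by apply: prodr_ge0 => i _; rewrite invr_ge0.
transitivity (\int[mu]_x (K%:E * (fun y => \int[lebesgue_rV n]_v
    f (cons_rV (y, v))) (M ord0 ord0 * x + w ord0 ord0)%R))%E.
  apply: eq_integral => x _.
  rewrite -(IH M' (x *: b + w') (fun v => f (cons_rV (M ord0 ord0 * x + w ord0 ord0, v)))).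
  - apply: eq_integral => v _; rewrite cons_rV_mulmx; congr (f (cons_rV (_, _))).
      rewrite mxE big1 ?addr0 1?mulrC// => i _.
      by rewrite !mxE tM// mulr0.
    by rewrite [RHS]addrA [v *m _ + _]addrC.
  - by move=> i j ij; rewrite mxE tM// /bump /= !add1n ltnS.
  - by move=> i; rewrite mxE.
  - by apply: (measurableT_comp mf); apply: measurable_fun_cons_rV.
  - by move=> v; exact: f0.
have mI := measurable_integral_rVS mf f0.
have I0 y : (0 <= \int[lebesgue_rV n]_v f (cons_rV (y, v)))%E by apply: integral_ge0.
rewrite ge0_integralZl//; last first.
  exact: (measurableT_comp mI (measurable_affine (M ord0 ord0) (w ord0 ord0))).
rewrite (ge0_integral_affine _
  (f := fun y => (\int[lebesgue_rV n]_v f (cons_rV (y, v)))%E))//.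
rewrite -integral_lebesgue_rVS// muleA -EFinM.
rewrite big_ord_recl mulrC; congr (_%:E * _)%E; congr (_ * _).
by apply: eq_bigr => i _; rewrite mxE.
Qed.

(** Here the remaining coordinates of [v *m M] do not involve the first one, so the first one is
    integrated innermost, as an affine change of variable on the line. *)
Lemma ge0_integral_lower_triangular n (M : 'M[R]_n) (w : 'rV[R]_n)
    (f : 'rV[R]_n -> \bar R) :
  (forall i j : 'I_n, (i < j)%N -> M i j = 0) -> (forall i, M i i != 0) ->
  measurable_fun setT f -> (forall v, 0 <= f v)%E ->
  (\int[lebesgue_rV n]_v f (v *m M + w)%R =
   (\prod_i `|M i i|^-1)%:E * \int[lebesgue_rV n]_v f v)%E.
Proof.
elim: n M w f => [|n IH] M w f tM dM mf f0.
  rewrite big_ord0 mul1e; apply: eq_integral => v _.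
  by congr f; apply/rowP => -[].
have mfM : measurable_fun setT (fun v : 'rV[R]_n.+1 => f (v *m M + w)).
  apply: (measurableT_comp mf); apply: measurable_addmx => //.
  exact: measurable_mulmx.
rewrite integral_lebesgue_rVSr//.
set M' := \matrix_(i, j) M (lift ord0 i) (lift ord0 j).
set w' := \row_j w ord0 (lift ord0 j).
have mI := measurable_integral_rVSr mf f0.
have I0 v : (0 <= \int[mu]_x f (cons_rV (x, v)))%E by apply: integral_ge0.
transitivity (\int[lebesgue_rV n]_v (`|M ord0 ord0|^-1%:E * (fun v => \int[mu]_x
    f (cons_rV (x, v))) (v *m M' + w')%R))%E.
  apply: eq_integral => v _.
  rewrite -(@ge0_integral_affine _ ((v *m (\col_i M (lift ord0 i) ord0)) ord0 ord0
     + w ord0 ord0) (fun x => f (cons_rV (x, v *m M' + w'))))//; last first.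
    by apply: (measurableT_comp mf); apply: measurable_fun_cons_rV.
  apply: eq_integral => x _; rewrite cons_rV_mulmx; congr (f (cons_rV (_, _))).
    by rewrite addrA [x * _]mulrC.
  congr (_ + _); rewrite (_ : \row_j _ = 0) ?scaler0 ?add0r//.
  by apply/rowP => j; rewrite !mxE tM.
rewrite ge0_integralZl//; last first.
  apply: (measurableT_comp mI); apply: measurable_addmx => //.
  exact: measurable_mulmx.
rewrite (IH _ _ (fun v => \int[mu]_x f (cons_rV (x, v)))%E)//; last 2 first.
  by move=> i j ij; rewrite mxE tM// /bump /= !add1n ltnS.
  by move=> i; rewrite mxE.
rewrite -integral_lebesgue_rVSr// muleA -EFinM.
rewrite big_ord_recl; congr (_%:E * _)%E; congr (_ * _).
by apply: eq_bigr => i _; rewrite mxE.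
Qed.

End lebesgue_rV_integral.

(** * Invertible matrices and dilations *)

Section linear_change_of_variables.
Context {R : realType}.
Notation mu := (@lebesgue_measure R).

(** Boxes are stable under intersection, generate the sigma-algebra, and include the cubes [g k],
    which have finite measure and exhaust the space. *)
Lemma lebesgue_rV_unique n (nu : {measure set 'rV[R]_n -> \bar R}) :
  (forall A : 'I_n -> set R, (forall i, measurable (A i)) ->
    nu [set v : 'rV[R]_n | forall i, A i (v ord0 i)] = (\prod_(i < n) mu (A i))%E) ->
  forall A, measurable A -> lebesgue_rV n A = nu A.
Proof.
move=> nuE.
pose G : set (set 'rV[R]_n) := [set B | exists2 A : 'I_n -> set R,
  (forall i, measurable (A i)) & B = [set v : 'rV[R]_n | forall i, A i (v ord0 i)]].
pose g (k : nat) : set 'rV[R]_n :=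
  [set v : 'rV[R]_n | forall i, `[- k%:R, k%:R]%classic (v ord0 i)].
apply: (@measure_unique _ _ _ G g).
- apply/seteqP; split => A.
    apply: smallest_sub; first exact: smallest_sigma_algebra.
    case: n nu nuE @G @g A => [|n] nu nuE G g A; first by rewrite big_ord0 => B [].
    rewrite -bigcup_mkord_ord => B [i /= ilt [C mC <-]].
    apply: sub_sigma_algebra.
    exists (fun j => if j == inord i then C else setT).
      by move=> j; case: ifP.
    apply/seteqP; split => v /=; first by move=> [_ Cv] j; case: eqP => // ->.
    by move=> /(_ (inord i)); rewrite eqxx.
  apply: smallest_sub; first exact: sigma_algebra_measurable.
  by move=> _ [B mB ->]; exact: measurable_box.
- move=> _ _ [A mA ->] [B mB ->]; exists (fun i => A i `&` B i).
    by move=> i; exact: measurableI.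
  by apply/seteqP; split => v /=; [move=> [Av Bv] i; split|
    move=> AB; split=> i; case: (AB i)].
- by move=> k; exists (fun=> `[- k%:R, k%:R]%classic).
- apply/seteqP; split => // v _.
  exists (\max_(i < n) (Num.truncn `|v ord0 i|).+1)%N => //= i.
  rewrite set_itvE/= -ler_norml (le_trans (ltW (truncnS_gt _)))// ler_nat.
  exact: (leq_bigmax (F := fun i => (Num.truncn `|v ord0 i|).+1)).
- by move=> _ [A mA ->]; rewrite nuE//; exact: lebesgue_rV_box.
- move=> k; have E : lebesgue_rV n (g k) = _ :=
    lebesgue_rV_box (fun=> measurable_itv `[- k%:R, k%:R]).
  apply: (@le_lt_trans _ _ (lebesgue_rV n (g k))) => //; rewrite E.
  rewrite ltey_eq; apply/orP; left.
  apply: (big_ind (fun x => x \is a fin_num)) => //.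
    by move=> x y; exact: fin_numM.
  move=> i _; rewrite lebesgue_measure_itv/=; case: ifP => // _.
Qed.

Lemma ge0_integral_perm_mx n (s : 'S_n) (f : 'rV[R]_n -> \bar R) :
  measurable_fun setT f -> (forall v, 0 <= f v)%E ->
  (\int[lebesgue_rV n]_v f (v *m perm_mx s)%R = \int[lebesgue_rV n]_v f v)%E.
Proof.
move=> mf f0.
pose phi (v : 'rV[R]_n) := v *m perm_mx s.
have mphi : measurable_fun setT phi by exact: measurable_mulmx.
transitivity (\int[pushforward (lebesgue_rV n) phi]_v f v)%E.
  by rewrite (ge0_integral_pushforward mphi).
have phiE v i : phi v ord0 i = v ord0 ((s^-1)%g i).
  by rewrite /phi -[s]invgK -col_permE mxE invgK.
pose nu : {measure set 'rV[R]_n -> \bar R} := pushforward (lebesgue_rV n) phi.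
apply/esym; apply: eq_measure_integral => A mA _.
apply: (@lebesgue_rV_unique n (nu mphi)) => // B mB.
have E : phi @^-1` [set v : 'rV[R]_n | forall i, B i (v ord0 i)] =
    [set v : 'rV[R]_n | forall i, B (s i) (v ord0 i)].
  apply/seteqP; split => v /= Bv i.
    by have := Bv (s i); rewrite phiE permK.
  by rewrite phiE; have := Bv ((s^-1)%g i); rewrite permKV.
apply: etrans (congr1 (lebesgue_rV n) E) _.
rewrite (lebesgue_rV_box (A := fun i => B (s i)))//.
by rewrite [RHS](reindex_inj (@perm_inj _ s)).
Qed.

(* c is 1 / |det M|, but its value is irrelevant here: it cancels in all the
   ratios of integrals considered below. *)
Lemma ge0_integral_mulmx n (M : 'M[R]_n) : M \in unitmx ->
  exists2 c : R, 0 < c & forall f : 'rV[R]_n -> \bar R,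
    measurable_fun setT f -> (forall v, 0 <= f v)%E ->
    (\int[lebesgue_rV n]_v f (v *m M)%R = c%:E * \int[lebesgue_rV n]_v f v)%E.
Proof.
case: n M => [|n] M uM.
  exists 1 => // f mf f0; rewrite mul1e; apply: eq_integral => v _.
  by congr f; apply/rowP => -[].
(* In the LUP decomposition the permutation and the unit lower triangular factor preserve the
   measure, so that only the diagonal of [U] contributes. *)
have := cormen_lup_correct M; have := cormen_lup_detL M.
have := @cormen_lup_lower _ _ M; have := @cormen_lup_upper _ _ M.
have := cormen_lup_perm M.
case: cormen_lup => [[P L] U]/= /is_perm_mxP[s ->] tU tL dL MLU.
have {MLU}ME : M = perm_mx s^-1 *m L *m U.
  rewrite -mulmxA [L *m U](_ : _ = perm_mx s *m M)//.
  by rewrite mulmxA -perm_mxM mulVg perm_mx1 mul1mx.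
have dU i : U i i != 0.
  have uU : U \in unitmx by move: uM; rewrite ME !unitmx_mul => /andP[].
  have := uU; rewrite -unitmx_tr unitmxE det_trig; last first.
    by apply/is_trig_mxP => j k jk; rewrite mxE tU.
  rewrite unitfE => /prodf_neq0 /(_ i isT); by rewrite mxE.
exists (\prod_i `|U i i|^-1).
  by apply: prodr_gt0 => i _; rewrite invr_gt0 normr_gt0.
move=> f mf f0; rewrite ME.
have mfX (A : 'M[R]_n.+1) : measurable_fun setT (fun v : 'rV[R]_n.+1 => f (v *m A)).
  by apply: (measurableT_comp mf); exact: measurable_mulmx.
under eq_integral do rewrite !mulmxA.
rewrite (@ge0_integral_perm_mx _ _ (fun v => f (v *m L *m U)))//; last first.
  under eq_fun do rewrite -mulmxA.
  exact: mfX.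
transitivity (\int[lebesgue_rV n.+1]_v f ((v *m L + 0) *m U))%E.
  by under [RHS]eq_integral do rewrite addr0.
rewrite (@ge0_integral_lower_triangular _ _ L 0 (fun v => f (v *m U)))//; last 2 first.
- by move=> i j ij; rewrite tL ?(ltnW ij)// -val_eqE /= (ltn_eqF ij).
- by move=> i; rewrite tL// eqxx oner_neq0.
rewrite big1 ?mul1e; last by move=> i _; rewrite tL// eqxx normr1 invr1.
rewrite -(@ge0_integral_upper_triangular _ _ U 0)//.
by under [RHS]eq_integral do rewrite addr0.
Qed.

(** Here the exact factor matters: in [integral_gauge] the scale [r] is itself a variable of
    integration. *)
Lemma ge0_integral_scale n (r : R) (f : 'rV[R]_n -> \bar R) : 0 < r ->
  measurable_fun setT f -> (forall v, 0 <= f v)%E ->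
  (\int[lebesgue_rV n]_v f v = (r ^+ n)%:E * \int[lebesgue_rV n]_v f (r *: v))%E.
Proof.
move=> r0 mf f0.
transitivity ((r ^+ n)%:E * \int[lebesgue_rV n]_v f (v *m r%:M + 0)%R)%E; last first.
  by under eq_integral do rewrite addr0 mul_mx_scalar.
rewrite ge0_integral_upper_triangular//.
- rewrite muleA -EFinM.
  under eq_bigr do rewrite mxE eqxx mulr1n gtr0_norm//.
  by rewrite prodr_const card_ord exprVn divff ?mul1e// expf_neq0// gt_eqF.
- by move=> i j ji; rewrite mxE -val_eqE /= (gtn_eqF ji).
- by move=> i; rewrite mxE eqxx gt_eqF.
Qed.

End linear_change_of_variables.

(** * Integrals over the line *)

Section one_dimensional.
Context {R : realType}.
Notation mu := (@lebesgue_measure R).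

Lemma cvgy_exprn_expRN k : (fun x : R => x ^+ k * expR (- x)) x @[x --> +oo%R] --> (0 : R).
Proof.
apply/cvgrPdist_le => e e0; near=> x.
have x0 : 0 < x by near: x; exact: nbhs_pinfty_gt.
rewrite sub0r normrN ger0_norm; last by rewrite mulr_ge0 ?exprn_ge0 ?expR_ge0// ltW.
rewrite expRN ler_pdivrMr ?expR_gt0//.
(* One Taylor term suffices: e^x >= x^(k+1)/(k+1)!, so the function is at most (k+1)!/x. *)
apply: (@le_trans _ _ (e * (x ^+ k.+1 / k.+1`!%:R))); last first.
  by rewrite ler_pM2l// (le_trans _ (expR_ge1Dxn k (ltW x0)))// lerDr.
rewrite exprS mulrAC mulrA ler_peMl ?exprn_ge0 ?(ltW x0)//.
rewrite mulrA ler_pdivlMr ?ltr0n ?fact_gt0// mul1r mulrC -ler_pdivrMr//.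
Unshelve. all: end_near. Qed.

(** Integration by parts in terms of primitives: each one is obtained from the previous by F_(k+1) =
    (k+1) F_k - x^(k+1) e^(-x). *)
Lemma gamma_primitive k : exists F : R -> R,
  [/\ forall x : R, is_derive x (1 : R) F (x ^+ k * expR (- x)),
      F 0 = - k`!%:R & F x @[x --> +oo%R] --> (0 : R)].
Proof.
elim: k => [|k [F [dF F0 Foo]]].
  exists (fun x => - expR (- x)); split.
  - by move=> x; apply: is_derive_eq; rewrite expr0 mul1r mulrN1 opprK.
  - by rewrite oppr0 expR0.
  - by rewrite -[X in _ --> X]oppr0; apply: cvgN; exact: cvgr_expR.
exists (fun x => k.+1%:R * F x - x ^+ k.+1 * expR (- x)); split.
- move=> x.
  have d1 : is_derive x (1 : R) (fun x => expR (- x)) (- expR (- x)).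
    by apply: is_derive_eq; rewrite mulrN1.
  have d2 : is_derive x (1 : R) (fun x : R => x ^+ k.+1) (k.+1%:R * x ^+ k).
    have := is_deriveX k.+1 (is_derive_id x (1 : R)); rewrite exprfctE scaler1; exact.
  have -> : x ^+ k.+1 * expR (- x) = k.+1%:R * (x ^+ k * expR (- x))
      - (x ^+ k.+1 * (- expR (- x)) + expR (- x) * (k.+1%:R * x ^+ k)).
    by rewrite exprS; ring.
  exact: (is_deriveB (is_deriveZ k.+1%:R (dF x)) (is_deriveM d2 d1)).
- by rewrite F0 expr0n/= mul0r subr0 mulrN -natrM -factS.
- have -> : (0 : R) = k.+1%:R * 0 - 0 by rewrite mulr0 subr0.
  apply: cvgB; last exact: cvgy_exprn_expRN.
  exact: cvgMr.
Qed.

Lemma integral_gamma k :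
  (\int[mu]_(x in `[0%R, +oo[) (x ^+ k * expR (- x))%:E = k`!%:R%:E)%E.
Proof.
have [F [dF F0 Foo]] := gamma_primitive k.
have cF : continuous F.
  by move=> x; apply/differentiable_continuous/derivable1_diffP; exact: ex_derive.
rewrite (@ge0_continuous_FTC2y _ _ F 0 0) ?F0 ?sub0e ?EFinN ?oppeK//.
- by move=> x x0; rewrite mulr_ge0 ?exprn_ge0 ?expR_ge0.
- apply/continuous_subspaceT => x.
  apply: cvgM; first exact: exprn_continuous.
  by apply: continuous_comp; [exact: opp_continuous|exact: continuous_expR].
- rewrite -F0; exact/cvg_at_right_filter/cF.
- by move=> x _; rewrite derive1E; exact: derive_val.
Qed.

End one_dimensional.

Lemma measurable_sgr (R : realType) : measurable_fun [set: R] (@Num.sg R).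
Proof.
rewrite (_ : Num.sg = fun x : R => if x == 0 then 0 else if x < 0 then -1 else 1).
  apply: measurable_fun_ifT => //; first exact: measurable_fun_eqr.
  by apply: measurable_fun_ifT => //; exact: measurable_fun_ltr.
by apply/funext => x; rewrite /Num.sg.
Qed.

(** * The l1 norm along a line *)

Section l1_line.
Context {R : realType} (n : nat) (h th : 'I_n -> R).
Notation mu := (@lebesgue_measure R).

Definition line_norm1 (t : R) : R := \sum_(i < n) `|h i + t * th i|.
(* The derivative of line_norm1 wherever no coordinate h i + t * th i vanishes
   with th i != 0. *)
Definition line_slope (t : R) : R := \sum_(i < n) Num.sg (h i + t * th i) * th i.

(** The sign is constant only on the open interval, as the function may vanish at an end; the
    formula for the absolute value survives there, both sides being 0, and the fundamental theorem
    of calculus needs it at the ends. *)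
Lemma abs_affine_no_zero (a b p q : R) : a < b ->
  (forall t, a < t < b -> q != 0 -> p + t * q != 0) ->
  exists c, (forall t, a < t < b -> Num.sg (p + t * q) = c) /\
            (forall t, a <= t <= b -> `|p + t * q| = c * (p + t * q)).
Proof.
move=> ab nz; have [->|q0] := eqVneq q 0.
  exists (Num.sg p); split=> t _; rewrite mulr0 addr0//.
  by rewrite normrEsg.
pose z := - p / q.
have pE t : p + t * q = (t - z) * q by rewrite mulrBl divfK// opprK addrC.
have [za|az] := leP z a.
  exists (Num.sg q); split => t /andP[at_ tb]; rewrite pE.
    by rewrite sgrM gtr0_sg ?mul1r// subr_gt0 (le_lt_trans za).
  by rewrite normrM ger0_norm ?subr_ge0 ?(le_trans za)// mulrCA -normrEsg.
have [bz|zb] := leP b z; last first.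
  by have := nz z; rewrite az zb => /(_ isT q0); rewrite pE subrr mul0r eqxx.
exists (- Num.sg q); split => t /andP[at_ tb]; rewrite pE.
  by rewrite sgrM ltr0_sg ?mulN1r// subr_lt0 (lt_le_trans tb).
rewrite normrM ler0_norm ?subr_le0 ?(le_trans tb)//.
by rewrite mulrCA !mulNr -normrEsg mulrN.
Qed.

Lemma measurable_line_slope : measurable_fun [set: R] line_slope.
Proof.
apply: measurable_sum => i; apply: measurable_funM => //.
apply: (measurableT_comp (@measurable_sgr R)).
by apply: measurable_funD => //; exact: measurable_funM.
Qed.

Lemma measurable_line_norm1 : measurable_fun [set: R] line_norm1.
Proof.
apply: measurable_sum => i; apply: measurableT_comp => //.
by apply: measurable_funD => //; exact: measurable_funM.
Qed.

Lemma continuous_line_norm1 : continuous line_norm1.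
Proof.
move=> t; apply: cvg_big => [|i _]; first exact: add_continuous.
apply: cvg_norm; apply: cvgD; first exact: cvg_cst.
by apply: cvgM; [exact: cvg_id|exact: cvg_cst].
Qed.

Definition line_density (t : R) : R := Num.max 0 (line_slope t) * expR (- line_norm1 t).

Lemma line_density_ge0 t : 0 <= line_density t.
Proof. by rewrite mulr_ge0 ?expR_ge0// le_max lexx. Qed.

Lemma measurable_line_density : measurable_fun [set: R] line_density.
Proof.
apply: measurable_funM.
  by apply: measurable_maxr => //; exact: measurable_line_slope.
by apply: measurableT_comp => //; apply: measurableT_comp => //; exact: measurable_line_norm1.
Qed.

(** Induction on a list containing all kinks in the interval. Without kinks the norm is affine and
    the density has an explicit primitive; a kink inside splits the interval and belongs to neither
    half, and a listed point outside is dropped. Asking only that [s] contain the kinks lets the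
    same tail serve both halves. *)
Lemma integral_line_density_oo (s : seq R) (a b : R) : a <= b ->
  (forall t i, a < t < b -> th i != 0 -> h i + t * th i = 0 -> t \in s) ->
  (forall t, a < t < b -> 0 <= line_slope t) ->
  (\int[mu]_(t in `]a, b[) (line_density t)%:E =
   (expR (- line_norm1 a) - expR (- line_norm1 b))%:E)%E.
Proof.
elim: s a b => [|c s IH] a b ab zs s0.
  move: ab; rewrite le_eqVlt => /predU1P[<-|ab].
    by rewrite subrr set_itvoo0 ?integral_set0.
  have nz i t : a < t < b -> th i != 0 -> h i + t * th i != 0.
    by move=> tab ti; apply/eqP => /(zs t i tab ti).
  have {nz}/choice[c cP] i := abs_affine_no_zero ab (nz i).
  pose al := \sum_(i < n) c i * h i; pose be := \sum_(i < n) c i * th i.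
  have NE t : a <= t <= b -> line_norm1 t = al + t * be.
    move=> tab; rewrite /al /be mulr_sumr -big_split/=; apply: eq_bigr => i _.
    by rewrite (cP i).2// mulrDr mulrCA.
  have SE t : a < t < b -> line_slope t = be.
    by move=> tab; apply: eq_bigr => i _; rewrite (cP i).1.
  (* Any interior point transfers the sign of the slope to its constant value [be]. *)
  have be0 : 0 <= be.
    have mab : a < (a + b) / 2 < b by rewrite midf_lt//= midf_lt.
    by rewrite -(SE _ mab) s0.
  transitivity (\int[mu]_(t in `]a, b[) (be * expR (- (al + t * be)))%:E)%E.
    apply: eq_integral => t; rewrite inE/= in_itv/= => tab.
    rewrite /line_density SE// NE; last by case/andP: tab => /ltW-> /ltW->.
    by rewrite (max_r be0).
  pose F (t : R) := - expR (- (al + t * be)).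
  have dF (t : R) : is_derive t (1 : R) F (be * expR (- (al + t * be))).
    by apply: is_derive_eq; rewrite scaler0 !add0r mul1r /GRing.scale/= mulr1 mulrN opprK mulrC.
  have cF : continuous F.
    by move=> x; apply/differentiable_continuous/derivable1_diffP; exact: ex_derive.
  have cf : continuous (fun t : R => be * expR (- (al + t * be))).
    rewrite (_ : (fun t => _) = (fun t => - be * F t)); last first.
      by apply/funext => t; rewrite /F mulrNN.
    by move=> x; apply: cvgMr; exact: cF.
  rewrite -(integral_itv_bndoo true false); last first.
    by apply/measurable_funTS/measurable_EFinP; exact: continuous_measurable_fun.
  rewrite (@continuous_FTC2 _ _ F)//.
  - rewrite /F !NE ?lexx ?(ltW ab)// -EFinB opprK addrC//.
  - exact: continuous_subspaceT.
  - split.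
    + by move=> x _; exact: ex_derive.
    + exact/cvg_at_right_filter/cF.
    + exact/cvg_at_left_filter/cF.
  - by move=> x _; rewrite derive1E; exact: derive_val.
have [/andP[ac cb]|cab] := boolP (a < c < b).
  have -> : `]a, b[%classic = `]a, c] `|` `]c, b[ :> set R.
    by rewrite -itv_bndbnd_setU// bnd_simp ltW.
  rewrite ge0_integral_setU//=; last 3 first.
  - apply/measurable_funTS/measurable_EFinP; exact: measurable_line_density.
  - by move=> x _; rewrite lee_fin line_density_ge0.
  - apply/disj_setPS => x /=; rewrite !in_itv/= => -[/andP[_ xc] /andP[cx _]].
    by move: cx; rewrite ltNge xc.
  rewrite -integral_itv_bndo_bndc; last first.
    apply/measurable_funTS/measurable_EFinP; exact: measurable_line_density.
  rewrite !IH ?ltW//.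
  - by rewrite -EFinD addrA subrK.
  - move=> t i /andP[ct tb] ti t0; have := zs t i; rewrite tb (lt_trans ac ct).
    by move=> /(_ isT ti t0); rewrite inE (gt_eqF ct).
  - by move=> t /andP[ct tb]; rewrite s0// tb (lt_trans ac ct).
  - move=> t i /andP[at_ tc] ti t0; have := zs t i; rewrite at_ (lt_trans tc cb).
    by move=> /(_ isT ti t0); rewrite inE (lt_eqF tc).
  - by move=> t /andP[at_ tc]; rewrite s0// at_ (lt_trans tc cb).
apply: IH => // t i tab ti t0.
have := zs t i tab ti t0; rewrite inE => /predU1P[tc|//].
by rewrite -tc tab in cab.
Qed.

(** Termwise |u + z| >= sg(u) (u + z); this also holds at a kink, where the sign is 0. *)
Lemma line_norm1_subgradient t t0 :
  line_norm1 t + line_slope t * (t0 - t) <= line_norm1 t0.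
Proof.
rewrite /line_slope mulr_suml -big_split/=; apply: ler_sum => i _.
set u := h i + t * th i.
have -> : h i + t0 * th i = u + th i * (t0 - t) by rewrite /u; ring.
move: u => u.
apply: le_trans (_ : Num.sg u * (u + th i * (t0 - t)) <= _).
  by rewrite le_eqVlt [`|u|]normrEsg; apply/orP; left; apply/eqP; ring.
rewrite (le_trans (ler_norm _))// normrM normr_sg ler_piMl//.
by rewrite lern1 leq_b1.
Qed.

Lemma line_norm1_coercive i t : `|t| * `|th i| - `|h i| <= line_norm1 t.
Proof.
rewrite /line_norm1 (bigD1 i)//= -[leLHS]addr0 lerD ?sumr_ge0//.
by rewrite -normrM [h i + _]addrC lerB_normD.
Qed.

Lemma line_norm1_min : (exists i, th i != 0) ->
  exists t0, forall t, line_norm1 t0 <= line_norm1 t.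
Proof.
move=> [i ti].
(* Beyond this radius coercivity forces the norm above its value at 0, so a minimum over the compact
   interval is global. *)
pose T := (line_norm1 0 + `|h i|) / `|th i|.
have N0 : 0 <= line_norm1 0 by apply: sumr_ge0.
have T0 : 0 <= T by rewrite divr_ge0// addr_ge0.
have [||c _ cmin] := @EVT_min R line_norm1 (- T) T.
- by rewrite ge0_cp.
- exact/continuous_subspaceT/continuous_line_norm1.
exists c => t; have [tT|Tt] := leP `|t| T.
  by apply: cmin; rewrite in_itv/= -ler_norml.
apply: (@le_trans _ _ (line_norm1 0)).
  by apply: cmin; rewrite in_itv/= oppr_le0 T0.
apply: le_trans (line_norm1_coercive i t).
by rewrite lerBrDr -ler_pdivrMr ?normr_gt0// ltW.
Qed.

(** By the subgradient inequality the slope is nonpositive before a minimizer and nonnegative after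
    it, so only the right half contributes, and there e^(-|.|_1) decreases to 0 from its value at
    [t0]. Flat stretches carry slope 0, so any minimizer will do. *)
Lemma integral_line_density t0 : (exists i, th i != 0) ->
  (forall t, line_norm1 t0 <= line_norm1 t) ->
  (\int[mu]_t (line_density t)%:E = (expR (- line_norm1 t0))%:E)%E.
Proof.
move=> [i ti] min0.
have mD (A : set R) : measurable_fun A (fun t => (line_density t)%:E).
  by apply/measurable_funTS/measurable_EFinP; exact: measurable_line_density.
have D0 t : (0 <= (line_density t)%:E)%E by rewrite lee_fin line_density_ge0.
have slope_ge0 t : t0 < t -> 0 <= line_slope t.
  move=> t0t; have := le_trans (line_norm1_subgradient t t0) (min0 t).
  rewrite gerDl -(opprB t t0) mulrN oppr_le0 pmulr_lge0//.
  by rewrite subr_gt0.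
have slope_le0 t : t < t0 -> line_slope t <= 0.
  move=> t0t; have := le_trans (line_norm1_subgradient t t0) (min0 t).
  rewrite gerDl pmulr_lle0//.
  by rewrite subr_gt0.
have -> : [set: R] = `]-oo, t0[ `|` `[t0, +oo[.
  by rewrite -itv_bndbnd_setU// set_itvE.
rewrite ge0_integral_setU//=; last first.
  apply/disj_setPS => x /=; rewrite !in_itv/= andbT => -[xt tx].
  by move: xt; rewrite ltNge tx.
  exact: mD.
rewrite [X in (X + _)%E](_ : _ = 0%E) ?add0e; last first.
  apply: integral0_eq => t /=; rewrite in_itv/= => /slope_le0 st.
  by rewrite /line_density (max_l st) mul0r.
rewrite -integral_itv_obnd_cbnd//.
have -> : `]t0, +oo[%classic = \bigcup_k `]t0, t0 + k%:R[%classic :> set R.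
  apply/seteqP; split => t /=.
    rewrite in_itv/= andbT => t0t; exists (Num.truncn (t - t0)).+1 => //=.
    by rewrite in_itv/= t0t/= -ltrBlDl truncnS_gt.
  by move=> [k _]/=; rewrite !in_itv/= andbT => /andP[].
have cv := @ge0_nondecreasing_set_cvg_integral _ (measurableTypeR R) R
  (fun k => `]t0, t0 + k%:R[%classic) (EFin \o line_density) mu.
apply: (cvg_unique _ (cv _ _ _ _)) => //.
- move=> k l kl; rewrite subsetEset; apply: subset_itvl.
  by rewrite bnd_simp lerD2l ler_nat.
- by move=> k; exact: mD.
- by move=> k t _; exact: D0.
- have key k : (\int[mu]_(t in `]t0, (t0 + k%:R)%R[) (line_density t)%:E =
      (expR (- line_norm1 t0) - expR (- line_norm1 (t0 + k%:R)))%:E)%E.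
    apply: (@integral_line_density_oo [seq - h i / th i | i : 'I_n]).
    + by rewrite lerDl.
    + move=> t j _ tj ht; apply/mapP; exists j; first by rewrite mem_enum.
      by apply: (mulIf tj); rewrite divfK//; apply/eqP; rewrite -addr_eq0 addrC ht.
    + by move=> t /andP[/slope_ge0].
  rewrite /= (_ : (fun k => _) = (fun k => (expR (- line_norm1 t0) -
      expR (- line_norm1 (t0 + k%:R)))%:E)); last by apply/funext => k; exact: key.
  apply: cvg_EFin; first exact: nearW.
  rewrite -[X in _ --> X]subr0; apply: cvgB; first exact: cvg_cst.
  have Noo : line_norm1 (t0 + k%:R) @[k --> \oo] --> +oo%R.
    apply/cvgryPge => A; near=> k.
    apply: le_trans (line_norm1_coercive i _).
    rewrite lerBrDr -ler_pdivrMr ?normr_gt0//.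
    rewrite (le_trans _ (ler_norm _))// -lerBlDl.
    by near: k; exact: nbhs_infty_ger.
  exact: (cvg_comp _ _ Noo (@cvgr_expR R)).
Unshelve. all: end_near. Qed.

End l1_line.

(** * Orthants and exponential moments *)

Section orthants.
Context {R : realType}.
Notation mu := (@lebesgue_measure R).

(** The recursion on the first coordinate matches that of [lebesgue_rV], so that integrals over
    orthants and sign sums are handled by the same induction. *)
Fixpoint signs n : seq 'rV[R]_n :=
  if n is m.+1 then [seq cons_rV (1, e) | e <- signs m] ++
    [seq cons_rV (-1, e) | e <- signs m] else [:: 0].

Definition emul n (e y : 'rV[R]_n) : 'rV[R]_n := \row_i (e ord0 i * y ord0 i).

Definition pos_ind n (y : 'rV[R]_n) : R := \prod_(i < n) (0 < y ord0 i)%R%:R.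

Lemma emul_cons n (a x : R) (e y : 'rV[R]_n) :
  emul (cons_rV (a, e)) (cons_rV (x, y)) = cons_rV (a * x, emul e y).
Proof.
by apply/rowP => i; rewrite mxE; case: (unliftP ord0 i) => [j|] ->;
  rewrite ?cons_rVS ?cons_rV0 ?mxE.
Qed.

Lemma pos_ind_cons n (x : R) (y : 'rV[R]_n) :
  pos_ind (cons_rV (x, y)) = (0 < x)%R%:R * pos_ind y.
Proof.
rewrite /pos_ind big_ord_recl cons_rV0; congr (_ * _).
by apply: eq_bigr => i _; rewrite cons_rVS.
Qed.

Lemma pos_ind_ge0 n (y : 'rV[R]_n) : 0 <= pos_ind y.
Proof. exact: prodr_ge0. Qed.

Lemma measurable_gt0_ind : measurable_fun [set: R] (fun x : R => (0 < x)%R%:R : R).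
Proof.
rewrite (_ : (fun _ => _) = (\1_(`]0, +oo[) : R -> R)).
  exact: measurable_indic.
by apply/funext => x; rewrite indicE mem_setE in_itv/= andbT.
Qed.

Lemma measurable_pos_ind n : measurable_fun setT (@pos_ind n).
Proof.
apply: measurable_prod => i _.
by apply: (measurableT_comp measurable_gt0_ind); exact: measurable_coord.
Qed.

Lemma measurable_emul n (e : 'rV[R]_n) : measurable_fun setT (emul e).
Proof.
apply/measurable_fun_rowP => i; under eq_fun do rewrite mxE.
by apply: measurable_funM => //; exact: measurable_coord.
Qed.

Lemma ge0_integral_half_lines (f : R -> \bar R) :
  measurable_fun [set: R] f -> (forall x, 0 <= f x)%E ->
  (\int[mu]_x f x = \int[mu]_x ((0 < x)%R%:R%:E * f (1 * x)%R)
                  + \int[mu]_x ((0 < x)%R%:R%:E * f (-1 * x)%R))%E.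
Proof.
move=> mf f0.
pose g x := ((x < 0)%R%:R%:E * f x)%E.
have gE : g = f \_ `]-oo, 0[.
  apply/funext => x; rewrite /g patchE mem_setE in_itv/=.
  by case: ifP => _; rewrite ?mul1e ?mul0e.
have mg : measurable_fun [set: R] g.
  rewrite gE; apply/(measurable_restrictT f) => //.
  exact: measurable_funTS.
have g0 x : (0 <= g x)%E by rewrite mule_ge0.
rewrite [X in (_ + X)%E](_ : _ = \int[mu]_x g x)%E; last first.
  transitivity (\int[mu]_x g (-1 * x + 0)%R)%E.
    by apply: eq_integral => x _; rewrite /g addr0 mulN1r oppr_lt0.
  by rewrite ge0_integral_affine ?oppr_eq0 ?oner_eq0// normrN1 invr1 mul1e.
rewrite [X in (X + _)%E](_ : _ = \int[mu]_(x in `]0%R, +oo[) f x)%E; last first.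
  rewrite [RHS]integral_mkcond; apply: eq_integral => x _.
  rewrite patchE mem_setE in_itv/= andbT mul1r.
  by case: ifP => _; rewrite ?mul1e ?mul0e.
rewrite gE -integral_mkcond addeC.
(* Neither open half-line contains 0; adding it to the positive one costs nothing. *)
rewrite integral_itv_obnd_cbnd; last exact: measurable_funTS.
rewrite -ge0_integral_setU//=.
- by rewrite -itv_bndbnd_setU// set_itvE.
- exact: measurable_funTS.
- apply/disj_setPS => x /=; rewrite !in_itv/= andbT => -[xt tx].
  by move: xt; rewrite ltNge tx.
Qed.

Lemma ge0_integral_orthants n (f : 'rV[R]_n -> \bar R) :
  measurable_fun setT f -> (forall x, 0 <= f x)%E ->
  (\int[lebesgue_rV n]_x f x =
   \sum_(e <- signs n) \int[lebesgue_rV n]_y ((pos_ind y)%:E * f (emul e y)))%E.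
Proof.
elim: n f => [|n IH] f mf f0.
  rewrite big_seq1; apply: eq_integral => y _.
  rewrite /pos_ind big_ord0 mul1e; congr f.
  by apply/rowP => -[].
rewrite big_cat/= !big_map integral_lebesgue_rVS//.
have mI := measurable_integral_rVS mf f0.
have I0 y : (0 <= \int[lebesgue_rV n]_v f (cons_rV (y, v)))%E by apply: integral_ge0.
rewrite (ge0_integral_half_lines mI)//.
have key (a : R) : (\int[mu]_x ((0 < x)%R%:R%:E *
    \int[lebesgue_rV n]_v f (cons_rV ((a * x)%R, v))) =
  \sum_(e <- signs n) \int[lebesgue_rV n.+1]_y
    ((pos_ind y)%:E * f (emul (cons_rV (a, e)) y)))%E.
  have mfa x : measurable_fun setT (fun v => f (cons_rV (a * x, v))).
    by apply: (measurableT_comp mf); apply: measurable_fun_cons_rV.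
  have mfe e : measurable_fun setT
      (fun y => (pos_ind y)%:E * f (emul (cons_rV (a, e)) y))%E.
    apply: emeasurable_funM.
      by apply/measurable_EFinP; exact: measurable_pos_ind.
    by apply: (measurableT_comp mf); exact: measurable_emul.
  have mIe e := measurable_integral_rVS (mfe e).
  rewrite [RHS](eq_bigr (fun e => \int[mu]_x \int[lebesgue_rV n]_y
     ((pos_ind (cons_rV (x, y)))%:E * f (emul (cons_rV (a, e)) (cons_rV (x, y)))))%E); last first.
    by move=> e _; rewrite integral_lebesgue_rVS// => v; rewrite mule_ge0// lee_fin pos_ind_ge0.
  rewrite -ge0_integral_sum//; last 2 first.
  - move=> e; apply: mIe => v; rewrite mule_ge0// lee_fin pos_ind_ge0//.
  - by move=> e x _; apply: integral_ge0 => v _; rewrite mule_ge0// lee_fin pos_ind_ge0.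
  apply: eq_integral => x _.
  rewrite (IH (fun v => f (cons_rV (a * x, v))))//.
  have mfae e : measurable_fun setT (fun v : 'rV[R]_n =>
      (pos_ind v)%:E * f (cons_rV ((a * x)%R, emul e v)))%E.
    apply: emeasurable_funM; first by apply/measurable_EFinP; exact: measurable_pos_ind.
    by apply: (measurableT_comp (mfa x)); exact: measurable_emul.
  rewrite ge0_sume_distrr; last first.
    by move=> e _; apply: integral_ge0 => v _; rewrite mule_ge0// lee_fin pos_ind_ge0.
  apply: eq_bigr => e _; rewrite -ge0_integralZl//.
  - by apply: eq_integral => v _; rewrite pos_ind_cons emul_cons EFinM muleA.
  - by move=> v _; rewrite mule_ge0// lee_fin pos_ind_ge0.
by rewrite key key.
Qed.

End orthants.

(** * Moments of independent exponential variables *)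

Section exponential_moments.
Context {R : realType}.
Notation mu := (@lebesgue_measure R).

Lemma ge0_integral_prod_rV n (f : 'I_n -> R -> R) :
  (forall i, measurable_fun [set: R] (f i)) -> (forall i x, 0 <= f i x) ->
  (\int[lebesgue_rV n]_y (\prod_(i < n) f i (y ord0 i))%:E =
   \prod_(i < n) \int[mu]_x (f i x)%:E)%E.
Proof.
elim: n f => [|n IH] f mf f0.
  under eq_integral do rewrite big_ord0.
  by rewrite big_ord0 integral_cst// mul1e /= diracT.
have mp m (g : 'I_m -> R -> R) : (forall i, measurable_fun [set: R] (g i)) ->
    measurable_fun setT (fun y : 'rV[R]_m => (\prod_(i < m) g i (y ord0 i))%:E).
  move=> mg; apply/measurable_EFinP; apply: measurable_prod => i _.
  by apply: (measurableT_comp (mg i)); exact: measurable_coord.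
rewrite integral_lebesgue_rVS//; last first.
- by move=> v; rewrite lee_fin prodr_ge0.
- exact: mp.
rewrite big_ord_recl.
transitivity (\int[mu]_x ((f ord0 x)%:E *
    \int[lebesgue_rV n]_y (\prod_(i < n) f (lift ord0 i) (y ord0 i))%:E))%E.
  apply: eq_integral => x _; rewrite -ge0_integralZl//.
  - apply: eq_integral => v _; rewrite -EFinM big_ord_recl cons_rV0.
    by congr (_ * _)%:E; apply: eq_bigr => i _; rewrite cons_rVS.
  - by apply: (mp _ (fun i => f (lift ord0 i))) => i; exact: mf.
  - by move=> v _; rewrite lee_fin prodr_ge0.
  - by rewrite lee_fin.
rewrite ge0_integralZr//.
- by rewrite (IH (fun i => f (lift ord0 i))).
- by apply/measurable_EFinP; exact: mf.
- by move=> x _; rewrite lee_fin.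
- by apply: integral_ge0 => v _; rewrite lee_fin prodr_ge0.
Qed.

(** The joint density of independent standard exponential variables. *)
Definition pos_density n (y : 'rV[R]_n) : R :=
  \prod_(i < n) ((0 < y ord0 i)%R%:R * expR (- y ord0 i)).

Lemma pos_density_ge0 n (y : 'rV[R]_n) : 0 <= pos_density y.
Proof. by apply: prodr_ge0 => i _; rewrite mulr_ge0 ?expR_ge0. Qed.

Lemma measurable_pos_density n : measurable_fun setT (@pos_density n).
Proof.
apply: measurable_prod => i _; apply: measurable_funM.
  by apply: (measurableT_comp measurable_gt0_ind); exact: measurable_coord.
apply: measurableT_comp => //; apply: measurableT_comp => //.
exact: measurable_coord.
Qed.

Lemma integral_monomial n (k : 'I_n -> nat) :
  (\int[lebesgue_rV n]_y ((\prod_(i < n) y ord0 i ^+ k i) * pos_density y)%:E =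
   (\prod_(i < n) (k i)`!%:R)%:E)%E.
Proof.
have mx j : measurable_fun [set: R] (fun x : R => x ^+ j * ((0 < x)%R%:R * expR (- x))).
  apply: measurable_funM; first exact: measurable_funX.
  apply: measurable_funM; first exact: measurable_gt0_ind.
  by apply: measurableT_comp => //; exact: measurableT_comp.
under eq_integral do rewrite -big_split/=.
rewrite (@ge0_integral_prod_rV n (fun i x => x ^+ k i * ((0 < x)%R%:R * expR (- x))))//; last first.
  move=> i x; have [x0|x0] := ltP 0 x; last by rewrite mul0r mulr0.
  by rewrite mul1r mulr_ge0 ?expR_ge0 ?exprn_ge0// ltW.
rewrite -prodEFin; apply: eq_bigr => i _.
rewrite -integral_gamma -integral_itv_obnd_cbnd; last first.
  apply/measurable_funTS/measurable_EFinP/measurable_funM; first exact: measurable_funX.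
  by apply: measurableT_comp => //; exact: measurableT_comp.
rewrite [RHS]integral_mkcond; apply: eq_integral => x _.
rewrite patchE mem_setE in_itv/= andbT.
by case: ifP => _; rewrite ?mul1r// mul0r mulr0.
Qed.

(* The expectation of y_i ^+ p * y_j ^+ p for independent standard exponential
   variables y. *)
Definition pair_moment n p (i j : 'I_n) : R :=
  if i == j then (2 * p)`!%:R else p`!%:R ^+ 2.

Lemma integral_pair_monomial n p (i j : 'I_n) :
  (\int[lebesgue_rV n]_y (y ord0 i ^+ p * y ord0 j ^+ p * pos_density y)%:E =
   (pair_moment p i j)%:E)%E.
Proof.
(* Adding the two indicators covers [i = j] as well, where the exponent becomes [2 * p]. *)
pose k (l : 'I_n) := (p * ((l == i) + (l == j)))%N.
have E (y : 'rV[R]_n) a : \prod_l y ord0 l ^+ (p * (l == a)) = y ord0 a ^+ p.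
  rewrite (bigD1 a)//= eqxx muln1 big1 ?mulr1// => l /negPf ->.
  by rewrite muln0.
transitivity (\int[lebesgue_rV n]_y ((\prod_(l < n) y ord0 l ^+ k l) * pos_density y)%:E)%E.
  apply: eq_integral => y _; rewrite /k.
  under eq_bigr do rewrite mulnDr exprD.
  by rewrite big_split/= !E.
rewrite integral_monomial /k /pair_moment; congr EFin.
rewrite (bigD1 i)//= eqxx; case: eqVneq => [->|ij].
  rewrite mulnC big1 ?mulr1// => l /negPf lj.
  by rewrite lj muln0.
rewrite (bigD1 j)/=; last by rewrite eq_sym.
rewrite eqxx [j == i]eq_sym (negPf ij) addn0 add0n muln1 big1 ?mulr1 ?expr2//.
by move=> l /andP[/negPf -> /negPf ->]; rewrite muln0.
Qed.

(** Used with [p = 1] for the second moment and [p = 2] for the bound on the fourth. The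
    coefficients may be negative, hence the proof goes through integrability. *)
Lemma integral_pair_form n p (q : 'I_n -> 'I_n -> R) :
  (\int[lebesgue_rV n]_y
     ((\sum_i \sum_j q i j * (y ord0 i ^+ p * y ord0 j ^+ p)) * pos_density y)%:E =
   (\sum_i \sum_j q i j * pair_moment p i j)%:E)%E.
Proof.
have mm i j : measurable_fun setT
    (fun y : 'rV[R]_n => (y ord0 i ^+ p * y ord0 j ^+ p * pos_density y)%:E).
  apply/measurable_EFinP/measurable_funM; last exact: measurable_pos_density.
  by apply: measurable_funM; apply: measurable_funX; exact: measurable_coord.
have mono_ge0 i j (y : 'rV[R]_n) : 0 <= y ord0 i ^+ p * y ord0 j ^+ p * pos_density y.
  rewrite /pos_density; have [/forallP y0|] := boolP [forall i, 0 < y ord0 i].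
    by rewrite !mulr_ge0 ?exprn_ge0 ?prodr_ge0// => *; rewrite ?ltW// mulr_ge0 ?expR_ge0.
  move=> /forallPn[l /negPf yl]; rewrite (bigD1 l)//= yl.
  by rewrite !mul0r mulr0.
have intm i j : (lebesgue_rV n).-integrable setT
    (fun y : 'rV[R]_n => (y ord0 i ^+ p * y ord0 j ^+ p * pos_density y)%:E).
  apply/integrableP; split; first exact: mm.
  under eq_integral do rewrite gee0_abs ?lee_fin ?mono_ge0//.
  by rewrite integral_pair_monomial ltry.
transitivity (\int[lebesgue_rV n]_y (\sum_i \sum_j
    ((q i j)%:E * (y ord0 i ^+ p * y ord0 j ^+ p * pos_density y)%:E)))%E.
  apply: eq_integral => y _; rewrite mulr_suml -sumEFin; apply: eq_bigr => i _.
  rewrite mulr_suml -sumEFin; apply: eq_bigr => j _.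
  by rewrite -EFinM !mulrA.
rewrite integral_sum//; last first.
  by move=> i; apply: integrable_sum => // j _; exact: integrableZl.
rewrite -sumEFin; apply: eq_bigr => i _.
rewrite integral_sum//; last by move=> j; exact: integrableZl.
rewrite -sumEFin; apply: eq_bigr => j _.
by rewrite integralZl// integral_pair_monomial EFinM.
Qed.

Lemma integral_pos_density n : (\int[lebesgue_rV n]_y (pos_density y)%:E = 1)%E.
Proof.
transitivity (\int[lebesgue_rV n]_y
    ((\prod_(i < n) y ord0 i ^+ 0%N) * pos_density y)%:E)%E.
  by apply: eq_integral => y _; rewrite big1 ?mul1r.
by rewrite (integral_monomial (fun=> 0%N)) big1.
Qed.

End exponential_moments.

(** * Sums over sign vectors *)

Section sign_sums.
Context {R : realType}.
Implicit Types n : nat.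

Lemma dotv_cons n (c : R) (e : 'rV[R]_n) (a : 'rV[R]_n.+1) :
  dotv (cons_rV (c, e)) a = c * a ord0 ord0 + dotv e (uncons_rV a).2.
Proof.
rewrite /dotv big_ord_recl cons_rV0; congr (_ + _).
by apply: eq_bigr => i _; rewrite cons_rVS mxE.
Qed.

Lemma dotvS n (a : 'rV[R]_n.+1) :
  dotv a a = a ord0 ord0 ^+ 2 + dotv (uncons_rV a).2 (uncons_rV a).2.
Proof.
rewrite /dotv big_ord_recl expr2; congr (_ + _).
by apply: eq_bigr => i _; rewrite !mxE.
Qed.

Lemma dotvv_ge0 n (a : 'rV[R]_n) : 0 <= dotv a a.
Proof. by apply: sumr_ge0 => i _; rewrite -expr2 sqr_ge0. Qed.

Lemma sum_signsS n (g : R -> R) (a : 'rV[R]_n.+1) :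
  \sum_(e <- signs n.+1) g (dotv e a) =
  \sum_(e <- signs n) (g (a ord0 ord0 + dotv e (uncons_rV a).2) +
                       g (- a ord0 ord0 + dotv e (uncons_rV a).2)).
Proof.
rewrite big_cat/= !big_map big_split/=; congr (_ + _); apply: eq_bigr => e _.
  by rewrite dotv_cons mul1r.
by rewrite dotv_cons mulN1r.
Qed.

Lemma signs_sqr n (e : 'rV[R]_n) i : e \in signs n -> e ord0 i ^+ 2 = 1.
Proof.
elim: n e i => [|n IH] e; first by case.
move=> i; rewrite mem_cat => /orP[] /mapP[e' e's ->];
  case: (unliftP ord0 i) => [j|] ->; rewrite ?cons_rVS ?cons_rV0 ?IH//.
- by rewrite expr1n.
- by rewrite sqrrN expr1n.
Qed.

Lemma sum_signs_cst n (c : R) : \sum_(e <- @signs R n) c = 2 ^+ n * c :> R.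
Proof.
elim: n c => [|n IH] c; first by rewrite big_seq1 mul1r.
by rewrite big_cat/= !big_map IH exprS; ring.
Qed.

Lemma sum_signs1 n (a : 'rV[R]_n) : \sum_(e <- signs n) dotv e a = 0.
Proof.
elim: n a => [|n IH] a; first by rewrite big_seq1 /dotv big_ord0.
rewrite (sum_signsS id)/= (eq_bigr (fun e => 2 * dotv e (uncons_rV a).2)).
  by rewrite -mulr_sumr IH mulr0.
by move=> e _; ring.
Qed.

Lemma sum_signs2 n (a : 'rV[R]_n) :
  \sum_(e <- signs n) dotv e a ^+ 2 = 2 ^+ n * dotv a a.
Proof.
elim: n a => [|n IH] a; first by rewrite big_seq1 /dotv !big_ord0 expr0n/= mulr0.
rewrite (sum_signsS (fun x => x ^+ 2))/=.
rewrite (eq_bigr (fun e => 2 * a ord0 ord0 ^+ 2 + 2 * dotv e (uncons_rV a).2 ^+ 2)).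
  by rewrite big_split/= sum_signs_cst -mulr_sumr IH dotvS (exprS 2 n); ring.
by move=> e _; ring.
Qed.

(** Khintchine's inequality with the Gaussian constant 3. Pairing the two signs of the first
    coordinate removes odd powers: (x+t)^4 + (t-x)^4 = 2x^4 + 12x^2t^2 + 2t^4. In the induction the
    mixed terms match exactly and only x^4 leaves slack. *)
Lemma sum_signs4 n (a : 'rV[R]_n) :
  \sum_(e <- signs n) dotv e a ^+ 4 <= 3 * 2 ^+ n * dotv a a ^+ 2.
Proof.
elim: n a => [|n IH] a; first by rewrite big_seq1 /dotv !big_ord0 !expr0n/= mulr0.
rewrite (sum_signsS (fun x => x ^+ 4))/= dotvS.
set x := a ord0 ord0; set b := (uncons_rV a).2.
rewrite (eq_bigr (fun e => 2 * x ^+ 4 + 12 * x ^+ 2 * dotv e b ^+ 2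
   + 2 * dotv e b ^+ 4)); last by move=> e _; ring.
rewrite !big_split/= sum_signs_cst -!mulr_sumr sum_signs2 (exprS 2 n).
have := IH b; set S := \sum_(e <- _) _; set D := dotv b b; set N := 2 ^+ n => SD.
have N0 : 0 <= N by rewrite exprn_ge0.
have xN : 0 <= x ^+ 4 * N by rewrite mulr_ge0// exprn_even_ge0.
lra.
Qed.

(** Same induction with the Gaussian sixth moment 15; the term in x^2 t^4 calls for the
    fourth-moment bound. *)
Lemma sum_signs6 n (a : 'rV[R]_n) :
  \sum_(e <- signs n) dotv e a ^+ 6 <= 15 * 2 ^+ n * dotv a a ^+ 3.
Proof.
elim: n a => [|n IH] a; first by rewrite big_seq1 /dotv !big_ord0 !expr0n/= mulr0.
rewrite (sum_signsS (fun x => x ^+ 6))/= dotvS.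
set x := a ord0 ord0; set b := (uncons_rV a).2.
rewrite (eq_bigr (fun e => 2 * x ^+ 6 + 30 * x ^+ 4 * dotv e b ^+ 2
   + 30 * x ^+ 2 * dotv e b ^+ 4 + 2 * dotv e b ^+ 6)); last by move=> e _; ring.
rewrite !big_split/= sum_signs_cst -!mulr_sumr sum_signs2 (exprS 2 n).
have S6 := IH b; have S4 := sum_signs4 b.
have D0 := dotvv_ge0 b.
move: S6 S4 D0; set S6 := \sum_(e <- _) _; set S4 := \sum_(e <- _) _.
set D := dotv b b => hS6 hS4 D0.
have N0 : 0 <= 2 ^+ n :> R by rewrite exprn_ge0.
set N := 2 ^+ n in N0 hS4 hS6 *.
have h4 : x ^+ 2 * S4 <= x ^+ 2 * (3 * N * D ^+ 2) by rewrite ler_wpM2l ?sqr_ge0.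
have x6 : 0 <= x ^+ 6 * N by rewrite mulr_ge0// exprn_even_ge0.
have x4 : 0 <= x ^+ 4 * (N * D) by rewrite mulr_ge0 ?exprn_even_ge0// mulr_ge0.
lra.
Qed.

(** The difference of the two sides is the variance of [z] under the weights [p]. *)
Lemma weighted_sqr_le n (p z : 'I_n -> R) : (forall i, 0 <= p i) ->
  \sum_i p i = 1 -> (\sum_i p i * z i) ^+ 2 <= \sum_i p i * z i ^+ 2.
Proof.
move=> p0 p1; set m := \sum_i p i * z i.
rewrite -subr_ge0.
have -> : \sum_i p i * z i ^+ 2 - m ^+ 2 = \sum_i p i * (z i - m) ^+ 2.
  rewrite [RHS](eq_bigr (fun i => p i * z i ^+ 2 - 2 * m * (p i * z i) + m ^+ 2 * p i)).
    rewrite big_split/= sumrB -!mulr_sumr p1 -/m; ring.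
  by move=> i _; ring.
by apply: sumr_ge0 => i _; rewrite mulr_ge0 ?sqr_ge0.
Qed.

Section weights.
Variables (n : nat) (th : 'rV[R]_n).
Hypothesis th1 : dotv th th = 1.

Definition sign_weight (e : 'rV[R]_n) : R := Num.max 0 (dotv e th).

Lemma sign_weight_ge0 e : 0 <= sign_weight e.
Proof. by rewrite le_max lexx. Qed.

(** Trades the positive part for an even polynomial, to which the sign sums above apply. *)
Lemma sign_weight_le e : sign_weight e <= (1 + dotv e th ^+ 2) / 2.
Proof.
have h := sqr_ge0 (dotv e th - 1); have h' := sqr_ge0 (dotv e th).
rewrite /sign_weight ge_max; apply/andP; split; lra.
Qed.

Lemma sum_sign_weight_ge : 5 / 18 * 2 ^+ n <= \sum_(e <- signs n) sign_weight e.
Proof.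
(* 4/27 is the smallest b such that t ^+ 2 - b * t ^+ 4 <= t for all t >= 0. *)
have key (s : R) : (s + s ^+ 2 - 4 / 27 * s ^+ 4) / 2 <= Num.max 0 s.
  have aux (t : R) : 0 <= t -> t ^+ 2 - 4 / 27 * t ^+ 4 <= t.
    (* This product is 27 (t - t^2) + 4 t^4; its double root 3/2 is the point of contact. *)
    move=> t0; have : 0 <= t * (t + 3) * (2 * t - 3) ^+ 2.
      by rewrite mulr_ge0 ?sqr_ge0// mulr_ge0// addr_ge0.
    lra.
  have [s0|s0] := leP 0 s; first by have := aux s s0; lra.
  have := aux (- s) ltac:(by rewrite oppr_ge0 ltW).
  rewrite sqrrN (_ : (- s) ^+ 4 = s ^+ 4); last by ring.
  lra.
apply: le_trans (_ : \sum_(e <- signs n)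
   (dotv e th + dotv e th ^+ 2 - 4 / 27 * dotv e th ^+ 4) / 2 <= _); last first.
  by apply: ler_sum => e _; exact: key.
(* Per sign vector this leaves (0 + 1 - 3 * 4/27) / 2 = 5/18. *)
rewrite -mulr_suml sumrB big_split/= -mulr_sumr sum_signs1 sum_signs2 th1.
have := sum_signs4 th; rewrite th1 expr1n.
lra.
Qed.

Lemma sum_sign_weight_sqr_le :
  \sum_(e <- signs n) sign_weight e * dotv e th ^+ 2 <= 2 * 2 ^+ n.
Proof.
apply: le_trans (_ : \sum_(e <- signs n)
   (dotv e th ^+ 2 + dotv e th ^+ 4) / 2 <= _).
  apply: ler_sum => e _.
  have := ler_wpM2r (sqr_ge0 (dotv e th)) (sign_weight_le e).
  by move=> h; apply: le_trans h _; lra.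
rewrite -mulr_suml big_split/= sum_signs2 th1.
have := sum_signs4 th; rewrite th1 expr1n.
lra.
Qed.

(** Write s = <e, th>, t = <e, a>, A = |a|^2. After [sign_weight_le] the mixed term s^2 t^4 is split
    by the weighted inequality x y^2 <= (x^3 + 2 y^3) / 3 at x = s^2, y = t^2 / A. The Khintchine
    bounds then give 3/2 + 15/6 + 15/3 = 9. Division by A forces the separate case A = 0. *)
Lemma sum_sign_weight4_le (a : 'rV[R]_n) :
  \sum_(e <- signs n) sign_weight e * dotv e a ^+ 4 <= 9 * 2 ^+ n * dotv a a ^+ 2.
Proof.
set A := dotv a a.
have [A0|A0] := eqVneq A 0.
  have a0 i : a ord0 i = 0.
    have /eqP := A0; rewrite /A /dotv psumr_eq0; last by move=> j _; rewrite -expr2 sqr_ge0.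
    by move=> /allP/(_ i); rewrite mem_index_enum => /(_ isT)/=; rewrite mulf_eq0 orbb => /eqP.
  rewrite big1; first by rewrite A0 expr0n/= mulr0.
  by move=> e _; rewrite /dotv (big1 _ _ (fun i => e ord0 i * a ord0 i)) ?expr0n/= ?mulr0// => i _;
    rewrite a0 mulr0.
have {A0}Agt0 : 0 < A by rewrite lt_neqAle eq_sym A0 dotvv_ge0.
have amgm (x y : R) : 0 <= x -> 0 <= y -> x * y ^+ 2 <= (x ^+ 3 + 2 * y ^+ 3) / 3.
  move=> x0 y0; have : 0 <= (x + 2 * y) * (x - y) ^+ 2.
    by rewrite mulr_ge0 ?sqr_ge0// addr_ge0// mulr_ge0.
  lra.
apply: le_trans (_ : \sum_(e <- signs n) (dotv e a ^+ 4 / 2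
   + A ^+ 2 / 6 * dotv e th ^+ 6 + A^-1 / 3 * dotv e a ^+ 6) <= _).
  apply: ler_sum => e _; set s := dotv e th; set t := dotv e a.
  have t4 : 0 <= t ^+ 4 by apply: exprn_even_ge0.
  apply: le_trans (ler_wpM2r t4 (sign_weight_le e)) _; rewrite -/s.
  have := amgm (s ^+ 2) (t ^+ 2 / A) (sqr_ge0 _) (divr_ge0 (sqr_ge0 _) (ltW Agt0)).
  move=> /(ler_wpM2l (sqr_ge0 A)).
  have -> : A ^+ 2 * (s ^+ 2 * (t ^+ 2 / A) ^+ 2) = s ^+ 2 * t ^+ 4.
    by field; rewrite gt_eqF.
  have -> : A ^+ 2 * (((s ^+ 2) ^+ 3 + 2 * (t ^+ 2 / A) ^+ 3) / 3) =
      A ^+ 2 / 3 * s ^+ 6 + 2 * (A^-1 / 3 * t ^+ 6).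
    by field; rewrite gt_eqF.
  lra.
rewrite !big_split/= -mulr_suml -!mulr_sumr.
have h4 := sum_signs4 a.
have h6 : A ^+ 2 / 6 * (\sum_(e <- signs n) dotv e th ^+ 6) <= A ^+ 2 / 6 * (15 * 2 ^+ n).
  rewrite ler_wpM2l//; first by rewrite divr_ge0 ?sqr_ge0.
  by have := sum_signs6 th; rewrite th1 expr1n mulr1.
have h6' : A^-1 / 3 * (\sum_(e <- signs n) dotv e a ^+ 6) <= 5 * 2 ^+ n * A ^+ 2.
  apply: le_trans (ler_wpM2l _ (sum_signs6 a)) _.
    by rewrite divr_ge0 ?invr_ge0 ?ltW.
  rewrite -/A le_eqVlt; apply/orP; left; apply/eqP; field; rewrite gt_eqF//.
rewrite -/A in h4; lra.
Qed.

(** Cauchy-Schwarz with |e|^2 = n: the difference is the squared norm of the projection of [e] onto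
    the hyperplane. *)
Lemma signs_dot_sqr_le e : e \in signs n -> dotv e th ^+ 2 <= n%:R.
Proof.
move=> es; rewrite -subr_ge0.
have -> : n%:R - dotv e th ^+ 2 = \sum_i (e ord0 i - dotv e th * th ord0 i) ^+ 2.
  rewrite (eq_bigr (fun i => 1 - 2 * dotv e th * (e ord0 i * th ord0 i)
     + dotv e th ^+ 2 * (th ord0 i * th ord0 i))).
    rewrite big_split/= sumrB -!mulr_sumr -/(dotv e th) -/(dotv th th) th1.
    by rewrite sumr_const card_ord; ring.
  by move=> i _; rewrite -[X in X - _ + _](signs_sqr i es); ring.
by apply: sumr_ge0 => i _; exact: sqr_ge0.
Qed.

End weights.

End sign_sums.

(** * The projection formula *)

Section orthogonal_projection.
Context {R : realType}.

Lemma dotvE k (x y : 'rV[R]_k) : dotv x y = (x *m y^T) ord0 ord0.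
Proof. by rewrite mxE; apply: eq_bigr => i _; rewrite mxE. Qed.

Lemma dotvC k (x y : 'rV[R]_k) : dotv x y = dotv y x.
Proof. by apply: eq_bigr => i _; rewrite mulrC. Qed.

Lemma dotvDl k (x y z : 'rV[R]_k) : dotv (x + y) z = dotv x z + dotv y z.
Proof. by rewrite !dotvE mulmxDl mxE. Qed.

Lemma dotvZl k a (x z : 'rV[R]_k) : dotv (a *: x) z = a * dotv x z.
Proof. by rewrite !dotvE -scalemxAl mxE. Qed.

Lemma dotvBl k (x y z : 'rV[R]_k) : dotv (x - y) z = dotv x z - dotv y z.
Proof. by rewrite -scaleN1r dotvDl dotvZl mulN1r. Qed.

Lemma dotv_orth_proj n (th x : 'rV[R]_n) : dotv th th = 1 ->
  dotv (orth_proj th x) (orth_proj th x) = dotv x x - dotv x th ^+ 2.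
Proof.
move=> th1; rewrite /orth_proj dotvBl dotvZl ![dotv _ (x - _)]dotvC !dotvBl !dotvZl th1.
by rewrite (dotvC th x); ring.
Qed.

Lemma measurable_dotv n (a : 'rV[R]_n) : measurable_fun setT (fun x : 'rV[R]_n => dotv x a).
Proof.
by apply: measurable_sum => i; apply: measurable_funM => //; exact: measurable_coord.
Qed.

Lemma measurable_orth_proj n (th : 'rV[R]_n) : measurable_fun setT (@orth_proj R n th).
Proof.
apply/measurable_fun_rowP => i; under eq_fun do rewrite !mxE.
apply: measurable_funB; first exact: measurable_coord.
by apply: measurable_funM => //; exact: measurable_dotv.
Qed.

End orthogonal_projection.

(** * The gauge of the projected ball and integration along fibres *)

Section hyperplane_projection.
Context {R : realType} (m : nat).
Notation n := m.+1.
Notation mu := (@lebesgue_measure R).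
Variables (th : 'rV[R]_n) (U : 'M[R]_(m, n)).
Hypothesis th1 : dotv th th = 1.
Hypothesis basisU : orthonormal_basis (hyperplane th) U.

Lemma dotv_basis v : dotv (v *m U) th = 0.
Proof.
have [_ rU] := basisU.
suff : hyperplane th (v *m U) by [].
by rewrite -rU; exists v.
Qed.

(** With [th] as first row, varying the first coordinate alone runs along a fibre of the
    projection. *)
Definition frame : 'M[R]_n := col_mx th U.

Lemma frame_unit : frame \in unitmx.
Proof.
have [UU _] := basisU.
have Uth : U *m th^T = 0.
  apply/matrixP => i j; rewrite ord1 mxE [RHS]mxE.
  apply: etrans (dotv_basis (delta_mx 0 i)); rewrite -rowE.
  by apply: eq_bigr => k _; rewrite !mxE.
have thU : th *m U^T = 0 by rewrite -[th *m U^T]trmxK trmx_mul trmxK Uth trmx0.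
have thth : th *m th^T = 1%:M.
  by apply/matrixP => i j; rewrite !ord1 -dotvE th1 mxE.
have fT : (col_mx th U) *m (col_mx th U)^T = 1%:M :> 'M[R]_(1 + m)%N.
  by rewrite tr_col_mx mul_col_row UU Uth thU thth -scalar_mx_block.
by have [] := mulmx1_unit fT.
Qed.

Lemma cons_rV_frame t v : cons_rV (t, v) *m frame = t *: th + v *m U.
Proof.
have := mul_row_col (t%:M : 'M[R]_1) v th U.
by rewrite mul_scalar_mx.
Qed.

Lemma orth_proj_frame t v : orth_proj th (t *: th + v *m U) = v *m U.
Proof.
rewrite /orth_proj dotvDl dotvZl dotv_basis th1 mulr1 addr0.
by rewrite addrAC subrr add0r.
Qed.

Definition coords (x : 'rV[R]_n) (i : 'I_n) : R := x ord0 i.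

Lemma coords_th_neq0 : exists i, coords th i != 0.
Proof.
apply/existsP; apply: contraPT th1 => /existsPn th0.
rewrite /dotv big1 => [/esym/eqP|i _]; first by rewrite oner_eq0.
by have := th0 i; rewrite negbK => /eqP; rewrite /coords => ->; rewrite mulr0.
Qed.

(* The gauge of the projection of the l1 ball, in the coordinates given by U; see
   projection_preimage. *)
Definition gauge (v : 'rV[R]_m) : R :=
  let h := coords (v *m U) in
  line_norm1 h (coords th) (projT1 (cid (line_norm1_min h coords_th_neq0))).

Lemma gauge_le v t : gauge v <= line_norm1 (coords (v *m U)) (coords th) t.
Proof. by rewrite /gauge; case: cid. Qed.

Lemma gauge_attained v : exists t, gauge v = line_norm1 (coords (v *m U)) (coords th) t.
Proof. by eexists. Qed.

Lemma gauge_ge0 v : 0 <= gauge v.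
Proof. by apply: sumr_ge0 => i _. Qed.

(** Homogeneity of the gauge, on level sets: the form needed after rescaling an integral by [r]. *)
Lemma gauge_scale_le r v : 0 < r -> (gauge (r *: v) <= r) = (gauge v <= 1).
Proof.
move=> r0.
have NE (s : R) (w : 'rV[R]_m) t : 0 < s ->
    line_norm1 (coords (s *: w *m U)) (coords th) (s * t) =
    s * line_norm1 (coords (w *m U)) (coords th) t.
  move=> s0; rewrite /line_norm1 mulr_sumr; apply: eq_bigr => i _.
  rewrite /coords -scalemxAl mxE -mulrA -mulrDr normrM gtr0_norm//.
have [t ht] := gauge_attained v; have [u hu] := gauge_attained (r *: v).
apply/idP/idP => h.
  rewrite -(ler_pM2l r0) mulr1; apply: le_trans h.
  rewrite hu -[u](mulVKf (lt0r_neq0 r0)) NE// ler_pM2l//.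
  exact: gauge_le.
apply: le_trans (gauge_le _ (r * t)) _.
by rewrite NE// -ht -[leRHS]mulr1 ler_pM2l.
Qed.

(** A point of H lies in the projection exactly when the line through it parallel to [th] meets the
    ball; since the minimum is attained, this means that it is at most 1. *)
Lemma projection_preimage v : (gauge v <= 1) <-> (orth_proj th @` l1_ball n) (v *m U).
Proof.
have NE t : line_norm1 (coords (v *m U)) (coords th) t =
    \sum_(i < n) `|(t *: th + v *m U) ord0 i|.
  apply: eq_bigr => i _; congr `|_|; rewrite /coords [in RHS]mxE addrC.
  by congr (_ + _); rewrite mxE.
split=> [g1|[x x1 xv]].
  have [t ht] := gauge_attained v.
  exists (t *: th + v *m U); last exact: orth_proj_frame.
  by rewrite /l1_ball/= -NE -ht.
apply: le_trans (gauge_le v (dotv x th)) _.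
by rewrite NE -xv /orth_proj addrC subrK.
Qed.


Lemma integral_line_gauge v :
  (\int[mu]_t (line_density (coords (v *m U)) (coords th) t)%:E =
   (expR (- gauge v))%:E)%E.
Proof.
have [t ht] := gauge_attained v.
rewrite ht; apply: integral_line_density; first exact: coords_th_neq0.
by move=> u; rewrite -ht; exact: gauge_le.
Qed.

Definition cone_density (x : 'rV[R]_n) : R :=
  Num.max 0 (\sum_(i < n) Num.sg (x ord0 i) * th ord0 i) *
  expR (- \sum_(i < n) `|x ord0 i|).

Lemma cone_density_ge0 x : 0 <= cone_density x.
Proof. by rewrite mulr_ge0 ?expR_ge0// le_max lexx. Qed.

Lemma measurable_cone_density : measurable_fun setT cone_density.
Proof.
apply: measurable_funM.
  apply: measurable_maxr => //; apply: measurable_sum => i.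
  apply: measurable_funM => //; apply: (measurableT_comp (@measurable_sgr R)).
  exact: measurable_coord.
apply: measurableT_comp => //; apply: measurableT_comp => //.
apply: measurable_sum => i; apply: measurableT_comp => //.
exact: measurable_coord.
Qed.

Lemma cone_density_frame t v :
  cone_density (cons_rV (t, v) *m frame) =
  line_density (coords (v *m U)) (coords th) t.
Proof.
have E i : (cons_rV (t, v) *m frame) ord0 i = coords (v *m U) i + t * coords th i.
  by rewrite cons_rV_frame mxE addrC; congr (_ + _); rewrite mxE.
congr (Num.max 0 _ * expR (- _)); apply: eq_bigr => i _; by rewrite E.
Qed.

(** The gauge is defined through a chosen minimizer, about whose dependence on [v] nothing is known.
    The line integral e^(-gauge) is measurable in [v] by Tonelli, and the gauge is recovered by a
    logarithm. *)
Lemma measurable_gauge : measurable_fun setT gauge.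
Proof.
have -> : gauge = (fun v => - ln (fine (\int[mu]_t
    (cone_density (cons_rV (t, v) *m frame))%:E)%E)).
  apply/funext => v; under eq_integral do rewrite cone_density_frame.
  by rewrite integral_line_gauge/= expRK opprK.
apply: measurableT_comp => //; apply: (measurableT_comp (@measurable_ln R)).
apply: (measurableT_comp (@fine_measurable R setT measurableT)) => //.
apply: (measurable_integral_rVSr (f := fun x => (cone_density (x *m frame))%:E)).
  apply/measurable_EFinP; apply: (measurableT_comp measurable_cone_density).
  exact: measurable_mulmx.
by move=> x; rewrite lee_fin cone_density_ge0.
Qed.

Lemma integral_expRN_itvcy (a : R) :
  (\int[mu]_(r in `[a, +oo[) (expR (- r))%:E = (expR (- a))%:E)%E.
Proof.
have dF (x : R) : is_derive x (1 : R) (fun x => - expR (- x)) (expR (- x)).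
  by apply: is_derive_eq; rewrite mulrN1 opprK.
have cF : continuous (fun x : R => - expR (- x)).
  by move=> x; apply/differentiable_continuous/derivable1_diffP; exact: ex_derive.
rewrite (@ge0_continuous_FTC2y _ _ (fun x => - expR (- x)) a 0).
- by rewrite sub0e EFinN oppeK.
- by move=> x _; exact: expR_ge0.
- apply/continuous_subspaceT => x.
  by apply: continuous_comp; [exact: opp_continuous|exact: continuous_expR].
- rewrite -[X in _ --> X]oppr0; apply: cvgN; exact: cvgr_expR.
- by move=> x _; exact: ex_derive.
- exact/cvg_at_right_filter/cF.
- by move=> x _; rewrite derive1E; exact: derive_val.
Qed.

(** Layer cake: e^(-gauge) is the integral of e^(-r) over r >= gauge. After exchanging integrals,
    the level set at r is r times the unit one, and the remaining integral of r^(m+d) e^(-r) is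
    (m+d)!. *)
Lemma integral_gauge d (g : 'rV[R]_m -> R) :
  measurable_fun setT g -> (forall v, 0 <= g v) ->
  (forall r v, 0 < r -> g (r *: v) = r ^+ d * g v) ->
  (\int[lebesgue_rV m]_v (g v * expR (- gauge v))%:E =
   (m + d)`!%:R%:E * \int[lebesgue_rV m]_v (g v * (gauge v <= 1)%R%:R)%:E)%E.
Proof.
move=> mg g0 gZ.
pose ind (b : bool) : R := if b then 1 else 0.
have indE b : ind b = b%:R by case: b.
have mind d' (T : measurableType d') (p : T -> bool) : measurable_fun setT p ->
    measurable_fun setT (fun x => (p x)%:R : R).
  by move=> mp; under eq_fun do rewrite -indE; exact: measurable_fun_ifT.
pose K (p : measurableTypeR R * 'rV[R]_m) : \bar R :=
  (g p.2 * ((0 < p.1)%R%:R * (gauge p.2 <= p.1)%R%:R * expR (- p.1)))%:E.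
have K0 p : (0 <= K p)%E by rewrite lee_fin !mulr_ge0 ?expR_ge0.
have mK : measurable_fun setT K.
  apply/measurable_EFinP; apply: measurable_funM.
    by apply: (measurableT_comp mg); exact: measurable_snd.
  apply: measurable_funM; last first.
    by apply: measurableT_comp => //; apply: measurableT_comp => //; exact: measurable_fst.
  apply: measurable_funM; apply: mind.
    by apply: measurable_fun_ltr => //; exact: measurable_fst.
  apply: measurable_fun_ler; last exact: measurable_fst.
  by apply: (measurableT_comp measurable_gauge); exact: measurable_snd.
transitivity (\int[lebesgue_rV m]_v \int[mu]_r K (r, v))%E.
  apply: eq_integral => v _; rewrite /K/= EFinM -integral_expRN_itvcy.
  rewrite -ge0_integralZl ?lee_fin//; first last.
    by apply/measurable_funTS/measurable_EFinP; exact: measurableT_comp.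
  (* [K] asks for [0 < r], because rescaling does; if the gauge is 0 this removes one point from the
     range of [r]. *)
  have [gv0|gv0] := eqVneq (gauge v) 0.
    rewrite gv0 -integral_itv_obnd_cbnd; last first.
      apply/measurable_funTS/measurable_EFinP; apply: measurable_funM => //.
      exact: measurableT_comp.
    rewrite integral_mkcond; apply: eq_integral => r _.
    rewrite patchE mem_setE in_itv/= andbT.
    have [r0|r0] := ltP 0 r; last by rewrite !mul0r mulr0.
    by rewrite (ltW r0) !mul1r EFinM.
  have gv : 0 < gauge v by rewrite lt_neqAle eq_sym gv0 gauge_ge0.
  rewrite integral_mkcond; apply: eq_integral => r _.
  rewrite patchE mem_setE in_itv/= andbT.
  have [gr|gr] := leP (gauge v) r; last by rewrite mulr0 mul0r mulr0.
  by rewrite (lt_le_trans gv gr) !mul1r EFinM.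
rewrite -(fubini_tonelli (m1 := mu) (m2 := lebesgue_rV m) K mK K0).
set J := (\int[lebesgue_rV m]_v (g v * (gauge v <= 1)%R%:R)%:E)%E.
have mG r : measurable_fun setT (fun v => (g v * (gauge v <= r)%R%:R)%:E).
  apply/measurable_EFinP; apply: measurable_funM => //; apply: mind.
  by apply: measurable_fun_ler => //; exact: measurable_gauge.
have J0 : (0 <= J)%E by apply: integral_ge0 => v _; rewrite lee_fin mulr_ge0.
transitivity (\int[mu]_r (((0 < r)%R%:R * (r ^+ (m + d) * expR (- r)))%:E * J))%E.
  apply: eq_integral => r _; rewrite /K/=; have [r0|r0] := ltP 0 r; last first.
    by rewrite mul0r mul0e integral0_eq// => v _; rewrite !mul0r mulr0.
  transitivity ((expR (- r))%:E * \int[lebesgue_rV m]_v (g v * (gauge v <= r)%R%:R)%:E)%E.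
    rewrite -ge0_integralZl ?lee_fin ?expR_ge0//.
    - apply: eq_integral => v _; rewrite -EFinM; congr EFin; rewrite mul1r; ring.
    - by move=> v _; rewrite lee_fin mulr_ge0.
  (* The volume contributes [r ^+ m] and the homogeneity of [g] contributes [r ^+ d]. *)
  rewrite (ge0_integral_scale r0)//; last by move=> v; rewrite lee_fin mulr_ge0.
  transitivity ((expR (- r))%:E * ((r ^+ m)%:E * \int[lebesgue_rV m]_v
      ((r ^+ d)%:E * (g v * (gauge v <= 1)%R%:R)%:E)))%E.
    congr (_ * (_ * _))%E; apply: eq_integral => v _.
    by rewrite gZ// gauge_scale_le// -EFinM mulrA.
  rewrite ge0_integralZl ?lee_fin ?exprn_ge0 ?(ltW r0)//; last first.
    by move=> v _; rewrite lee_fin mulr_ge0.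
  by rewrite !muleA -!EFinM mul1r exprD; congr (_%:E * _)%E; ring.
rewrite ge0_integralZr//.
- congr (_ * _)%E; rewrite -integral_gamma -integral_itv_obnd_cbnd; last first.
    apply/measurable_funTS/measurable_EFinP/measurable_funM; first exact: measurable_funX.
    by apply: measurableT_comp => //; exact: measurableT_comp.
  rewrite [RHS]integral_mkcond; apply: eq_integral => x _.
  rewrite patchE mem_setE in_itv/= andbT.
  by case: ifP => _; rewrite ?mul1r// mul0r.
- apply/measurable_EFinP; apply: measurable_funM; first exact: measurable_gt0_ind.
  apply: measurable_funM; first exact: measurable_funX.
  by apply: measurableT_comp => //; exact: measurableT_comp.
- move=> r _; rewrite lee_fin; have [r0|r0] := ltP 0 r; last by rewrite mul0r.
  by rewrite mul1r mulr_ge0 ?expR_ge0// exprn_ge0// ltW.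
Qed.

(** On the open orthant of [e] the slope is the constant <e, th> and the l1 norm is the sum of the
    y_i. *)
Lemma cone_density_emul e y : e \in signs n ->
  pos_ind y * cone_density (emul e y) = sign_weight th e * pos_density y.
Proof.
move=> es; rewrite /pos_ind /pos_density.
have [/forallP y0|/forallPn[l /negPf yl]] := boolP [forall i, 0 < y ord0 i]; last first.
  by rewrite [X in X * _ = _](bigD1 l)// [X in _ = _ * X](bigD1 l)//= yl !mul0r mulr0.
rewrite big1 ?mul1r; last by move=> i _; rewrite y0.
rewrite [X in _ = _ * X](eq_bigr (fun i => expR (- y ord0 i))); last first.
  by move=> i _; rewrite y0 mul1r.
have ei i : e ord0 i = 1 \/ e ord0 i = -1.
  have /eqP := signs_sqr i es; rewrite sqrf_eq1 => /orP[] /eqP; tauto.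
rewrite -expR_sum /cone_density /sign_weight; congr (Num.max 0 _ * expR _).
  apply: eq_bigr => i _; rewrite mxE sgrM (gtr0_sg (y0 i)) mulr1.
  by case: (ei i) => ->; rewrite ?sgr1// sgrN sgr1.
rewrite -sumrN; apply: eq_bigr => i _; rewrite mxE normrM (gtr0_norm (y0 i)).
by case: (ei i) => ->; rewrite ?normrN normr1 mul1r.
Qed.

(** The constant is quantified before [d] and [g], so that the instance [g = 1], [d = 0] normalizes
    all the others. *)
Lemma projection_formula : exists2 c : R, 0 < c &
  forall d (g : 'rV[R]_n -> R), measurable_fun setT g -> (forall x, 0 <= g x) ->
  (forall r x, 0 < r -> g (r *: x) = r ^+ d * g x) ->
  (\sum_(e <- signs n) (sign_weight th e)%:E * \int[lebesgue_rV n]_y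
     (g (orth_proj th (emul e y)) * pos_density y)%:E =
   c%:E * ((m + d)`!%:R%:E * \int[lebesgue_rV m]_v
     (g (v *m U) * (gauge v <= 1)%R%:R)%:E))%E.
Proof.
have [c c0 cE] := ge0_integral_mulmx frame_unit.
exists c^-1; rewrite ?invr_gt0// => d g mg g0 gZ.
pose F x := (g (orth_proj th x) * cone_density x)%:E.
have mF : measurable_fun setT F.
  apply/measurable_EFinP/measurable_funM; last exact: measurable_cone_density.
  exact: (measurableT_comp mg (measurable_orth_proj th)).
have F0 x : (0 <= F x)%E by rewrite lee_fin mulr_ge0 ?cone_density_ge0.
have mgU : measurable_fun setT (fun v : 'rV[R]_m => g (v *m U)).
  by apply: (measurableT_comp mg); exact: measurable_mulmx.
rewrite -integral_gauge//; last by move=> r v r0; rewrite -scalemxAl gZ.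
transitivity (\int[lebesgue_rV n]_x F x)%E.
  rewrite ge0_integral_orthants// [RHS]big_seq [LHS]big_seq; apply: eq_bigr => e es.
  rewrite -ge0_integralZl ?lee_fin ?sign_weight_ge0//.
  - apply: eq_integral => y _; rewrite /F -!EFinM; congr EFin.
    by rewrite mulrCA [RHS]mulrCA cone_density_emul// mulrCA.
  - apply/measurable_EFinP/measurable_funM; last exact: measurable_pos_density.
    apply: (measurableT_comp mg); apply: (measurableT_comp (measurable_orth_proj th)).
    exact: measurable_emul.
  - by move=> y _; rewrite lee_fin mulr_ge0 ?pos_density_ge0.
transitivity (c^-1%:E * \int[lebesgue_rV n]_x F (x *m frame)%R)%E.
  by rewrite cE// muleA -EFinM mulVf ?mul1e// gt_eqF.
congr (_ * _)%E.
rewrite (integral_lebesgue_rVSr (f := fun x => F (x *m frame)))//; last first.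
  by apply: (measurableT_comp mF); exact: measurable_mulmx.
apply: eq_integral => v _; rewrite EFinM -integral_line_gauge -ge0_integralZl ?lee_fin//.
- apply: eq_integral => t _; rewrite -EFinM /F cone_density_frame cons_rV_frame.
  by rewrite orth_proj_frame.
- by apply/measurable_EFinP; exact: measurable_line_density.
- by move=> t _; rewrite lee_fin line_density_ge0.
Qed.

End hyperplane_projection.

(** * Moments of the uniform distribution *)

Section weighted_moments.
Context {R : realType} (n : nat) (th : 'rV[R]_n).
Hypothesis th1 : dotv th th = 1.

Lemma sumr_delta (f : 'I_n -> 'I_n -> R) :
  \sum_i \sum_j (i == j)%:R * f i j = \sum_i f i i.
Proof.
apply: eq_bigr => i _; rewrite (bigD1 i)//= eqxx mul1r big1 ?addr0// => j.
by rewrite eq_sym => /negPf ->; rewrite mul0r.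
Qed.

Lemma sqr_sum (a : 'I_n -> R) : (\sum_i a i) ^+ 2 = \sum_i \sum_j a i * a j.
Proof. by rewrite expr2 big_distrlr. Qed.

Lemma dotv_emul_emul (e y : 'rV[R]_n) : e \in signs n ->
  dotv (emul e y) (emul e y) = \sum_i y ord0 i ^+ 2.
Proof.
move=> es; apply: eq_bigr => i _.
by rewrite mxE -expr2 exprMn (signs_sqr i es) mul1r.
Qed.

Lemma dotv_emul (e y : 'rV[R]_n) : dotv (emul e y) th = dotv e (emul th y).
Proof. by apply: eq_bigr => i _; rewrite !mxE -!mulrA [y _ _ * _]mulrC. Qed.

Definition proj_sqr (x : 'rV[R]_n) : R := dotv (orth_proj th x) (orth_proj th x).

(** As E y_i y_j = 1 + [i = j], E|y|^2 = 2n and E<e y, th>^2 = <e, th>^2 + |th|^2. *)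
Lemma integral_proj_sqr e : e \in signs n ->
  (\int[lebesgue_rV n]_y (proj_sqr (emul e y) * pos_density y)%:E =
   (n%:R *+ 2 - 1 - dotv e th ^+ 2)%:E)%E.
Proof.
move=> es; pose a i := e ord0 i * th ord0 i.
have sumE : \sum_i a i = dotv e th by [].
have sum_sqr : \sum_i a i ^+ 2 = 1.
  rewrite -th1; apply: eq_bigr => i _.
  by rewrite /a exprMn (signs_sqr i es) mul1r expr2.
transitivity (\int[lebesgue_rV n]_y ((\sum_i \sum_j
    ((i == j)%:R - a i * a j) * (y ord0 i ^+ 1 * y ord0 j ^+ 1)) * pos_density y)%:E)%E.
  apply: eq_integral => y _; congr (_ * _)%:E.
  rewrite /proj_sqr dotv_orth_proj// dotv_emul_emul// sqr_sum.
  under [RHS]eq_bigr do under eq_bigr do rewrite mulrBl !expr1.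
  under [RHS]eq_bigr do rewrite sumrB.
  rewrite sumrB (sumr_delta (fun i j => y ord0 i * y ord0 j)).
  congr (_ - _); apply: eq_bigr => i _; apply: eq_bigr => j _.
  by rewrite !mxE /a; ring.
rewrite integral_pair_form; congr EFin.
have mE i j : pair_moment 1 i j = (1 + (i == j)%:R) :> R.
  by rewrite /pair_moment; case: (i == j); rewrite ?expr1n ?addr0.
transitivity (\sum_i \sum_j (i == j)%:R * (2 - a i * a j) - \sum_i \sum_j a i * a j).
  rewrite -sumrB; apply: eq_bigr => i _; rewrite -sumrB; apply: eq_bigr => j _.
  by rewrite mE; case: (i == j) => /=; ring.
rewrite (sumr_delta (fun i j => 2 - a i * a j)) -sqr_sum sumE sumrB.
rewrite (eq_bigr (fun i => a i ^+ 2) (fun i _ => erefl : a i * a i = _)) sum_sqr.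
by rewrite sumr_const card_ord; ring.
Qed.

(** For A, t^2 >= 0 one has (A - t^2)^2 <= A^2 + t^4; the lost cross term is of lower order. Summing
    over signs at fixed [y] allows the Khintchine bound for the vector (th_i y_i), and Jensen with
    weights th_i^2 makes its square diagonal in the y_i^2. *)
Lemma sum_weight_proj_quartic_le (y : 'rV[R]_n) :
  \sum_(e <- signs n) sign_weight th e * proj_sqr (emul e y) ^+ 2 <=
  \sum_i \sum_j (\sum_(e <- signs n) sign_weight th e
    + (i == j)%:R * (9 * 2 ^+ n * th ord0 i ^+ 2)) * (y ord0 i ^+ 2 * y ord0 j ^+ 2).
Proof.
set W := \sum_(e <- signs n) sign_weight th e.
apply: (@le_trans _ _ (\sum_(e <- signs n) sign_weight th e *
    ((\sum_i y ord0 i ^+ 2) ^+ 2 + dotv e (emul th y) ^+ 4))).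
  rewrite [leLHS]big_seq [leRHS]big_seq; apply: ler_sum => e es.
  rewrite ler_wpM2l ?sign_weight_ge0// /proj_sqr dotv_orth_proj//.
  rewrite dotv_emul_emul// dotv_emul.
  set A := \sum_i _; set t := dotv e _.
  have : 0 <= A * t ^+ 2 by rewrite mulr_ge0 ?sqr_ge0// sumr_ge0// => i _; rewrite sqr_ge0.
  lra.
under eq_bigr do rewrite mulrDr.
rewrite big_split/= -mulr_suml -/W.
apply: le_trans (lerD (lexx _) (sum_sign_weight4_le th1 (emul th y))) _.
have -> : \sum_i \sum_j (W + (i == j)%:R * (9 * 2 ^+ n * th ord0 i ^+ 2)) *
    (y ord0 i ^+ 2 * y ord0 j ^+ 2) =
    W * (\sum_i y ord0 i ^+ 2) ^+ 2 + 9 * 2 ^+ n * \sum_i th ord0 i ^+ 2 * (y ord0 i ^+ 2) ^+ 2.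
  rewrite sqr_sum !mulr_sumr.
  rewrite -(sumr_delta (fun i j => 9 * 2 ^+ n *
    (th ord0 i ^+ 2 * (y ord0 i ^+ 2 * y ord0 j ^+ 2)))).
  rewrite -big_split/=; apply: eq_bigr => i _; rewrite mulr_sumr -big_split/=.
  by apply: eq_bigr => j _; ring.
rewrite lerD2l ler_wpM2l ?mulr_ge0 ?exprn_ge0//.
have -> : dotv (emul th y) (emul th y) = \sum_i th ord0 i ^+ 2 * y ord0 i ^+ 2.
  by apply: eq_bigr => i _; rewrite !mxE; ring.
apply: weighted_sqr_le => [i|]; first exact: sqr_ge0.
by rewrite -th1; apply: eq_bigr => i _; rewrite expr2.
Qed.

Lemma measurable_proj_sqr : measurable_fun setT proj_sqr.
Proof.
rewrite (_ : proj_sqr = fun x : 'rV[R]_n => dotv x x - dotv x th ^+ 2); last first.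
  by apply/funext => x; exact: dotv_orth_proj.
apply: measurable_funB.
  by apply: measurable_sum => i; apply: measurable_funM; exact: measurable_coord.
apply: measurable_funX; apply: measurable_sum => i; apply: measurable_funM => //.
exact: measurable_coord.
Qed.

(** E y_i^2 y_j^2 is 4 off the diagonal and 24 = 4 + 20 on it; 216 = 9 * 24. *)
Lemma sum_weight_proj_quartic_integral_le :
  (\sum_(e <- signs n) (sign_weight th e)%:E *
     \int[lebesgue_rV n]_y (proj_sqr (emul e y) ^+ 2 * pos_density y)%:E <=
   ((\sum_(e <- signs n) sign_weight th e) * (4 * n%:R ^+ 2 + 20 * n%:R) +
     216 * 2 ^+ n)%:E)%E.
Proof.
set W := \sum_(e <- signs n) sign_weight th e.
have W0 : 0 <= W by apply: sumr_ge0 => e _; exact: sign_weight_ge0.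
have mq e : measurable_fun setT
    (fun y => (proj_sqr (emul e y) ^+ 2 * pos_density y)%:E).
  apply/measurable_EFinP/measurable_funM; last exact: measurable_pos_density.
  apply: measurable_funX; apply: (measurableT_comp measurable_proj_sqr).
  exact: measurable_emul.
have q0 e y : (0 <= (proj_sqr (emul e y) ^+ 2 * pos_density y)%:E)%E.
  by rewrite lee_fin mulr_ge0 ?sqr_ge0 ?pos_density_ge0.
under eq_bigr do rewrite -ge0_integralZl ?lee_fin ?sign_weight_ge0//.
rewrite -ge0_integral_sum//; last 2 first.
- by move=> e; exact: measurable_funeM.
- by move=> e y _; rewrite mule_ge0// lee_fin sign_weight_ge0.
pose q i j := W + (i == j)%:R * (9 * 2 ^+ n * th ord0 i ^+ 2).
have qE : \sum_i \sum_j q i j * pair_moment 2 i j =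
    W * (4 * n%:R ^+ 2 + 20 * n%:R) + 216 * 2 ^+ n.
  have mE i j : pair_moment 2 i j = (4 + (i == j)%:R * 20) :> R.
    rewrite /pair_moment; case: (i == j) => /=.
      by rewrite (_ : (2 * 2)`! = 24)%N//; ring.
    by rewrite (_ : 2`! = 2)%N//; ring.
  transitivity (\sum_(i < n) \sum_(j < n) 4 * W +
      \sum_i \sum_j (i == j)%:R * (20 * W + 216 * 2 ^+ n * th ord0 i ^+ 2)).
    rewrite -big_split/=; apply: eq_bigr => i _; rewrite -big_split/=; apply: eq_bigr => j _.
    by rewrite mE /q; case: (i == j) => /=; ring.
  rewrite (sumr_delta (fun i j => 20 * W + 216 * 2 ^+ n * th ord0 i ^+ 2)).
  rewrite big_split/= -[X in _ + (_ + X)]mulr_sumr.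
  rewrite (_ : \sum_i th ord0 i ^+ 2 = 1); last first.
    by rewrite -th1; apply: eq_bigr => i _; rewrite expr2.
  by rewrite !sumr_const card_ord; ring.
rewrite -qE -integral_pair_form; apply: ge0_le_integral => //.
- by move=> y _; apply: sume_ge0 => e _; rewrite mule_ge0// lee_fin sign_weight_ge0.
- by apply: emeasurable_sum => e; exact: measurable_funeM.
- apply/measurable_EFinP/measurable_funM; last exact: measurable_pos_density.
  apply: measurable_sum => i; apply: measurable_sum => j; apply: measurable_funM => //.
  by apply: measurable_funM; apply: measurable_funX; exact: measurable_coord.
- move=> y _.
  under eq_bigr do rewrite -EFinM mulrA.
  rewrite sumEFin lee_fin -mulr_suml ler_wpM2r ?pos_density_ge0//.
  exact: sum_weight_proj_quartic_le.
Qed.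

End weighted_moments.

Lemma ge0_integral_mrestr d (T : measurableType d) (R : realType)
    (mu : {measure set T -> \bar R}) (D : set T) (mD : measurable D) (f : T -> \bar R) :
  measurable_fun setT f -> (forall x, 0 <= f x)%E ->
  (\int[mrestr mu mD]_x f x = \int[mu]_(x in D) f x)%E.
Proof.
move=> mf f0.
rewrite -(setUv D) ge0_integral_setU//.
- rewrite [X in (_ + X)%E](_ : _ = \int[mzero]_(x in ~` D) f x)%E.
    rewrite integral_measure_zero adde0; apply: eq_measure_integral => A mA AD.
    by rewrite -[in RHS](setIidl AD).
  apply: eq_measure_integral => A mA AD.
  have AD0 : A `&` D = set0 by apply/seteqP; split => // x [/AD].
  by apply: etrans (congr1 mu AD0) _; rewrite measure0.
- exact: measurableC.
- by rewrite setUv.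
- by apply/disj_setPS => x [].
Qed.

(** * Moments of X and the comparison with the covariance *)

Section uniform_on_projection.
Context {R : realType} (m : nat).
Notation n := m.+1.
Variables (th : 'rV[R]_n) (U : 'M[R]_(m, n)).
Hypothesis th1 : dotv th th = 1.
Hypothesis basisU : orthonormal_basis (hyperplane th) U.
Context d (T : measurableType d) (P : probability T R) (X : {RV P >-> 'rV[R]_n}).
Local Notation K := (orth_proj th @` l1_ball n).
Hypothesis unifX : forall A, measurable A ->
  distribution P X A = (subspace_lebesgue U (A `&` K) / subspace_lebesgue U K)%E.

Local Notation gauge := (gauge U th1).
Local Notation gauge_ball := [set v | gauge v <= 1].
Local Notation weight_sum := (\sum_(e <- signs n) sign_weight th e).

Lemma weight_sum_gt0 : 0 < weight_sum.
Proof.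
apply: lt_le_trans (sum_sign_weight_ge th1).
by rewrite mulr_gt0// exprn_gt0.
Qed.

Lemma measurable_gauge_le1 : measurable gauge_ball.
Proof.
have := measurable_gauge U th1 measurableT (measurable_itv `]-oo, 1%R]).
by rewrite setTI.
Qed.

Lemma gauge_le1E : gauge_ball = (fun v => v *m U) @^-1` K.
Proof. by apply/seteqP; split => v /= /(projection_preimage th1 basisU). Qed.

(** The projection formula with [g = 1] expresses the total weight, which is positive and finite,
    through the volume; hence the volume is positive and finite too, without any geometric
    argument. *)
Lemma projection_volume : exists2 c : R, 0 < c & exists2 k : R, 0 < k &
  [/\ lebesgue_rV m gauge_ball = k%:E,
      weight_sum = c * (m`!%:R * k) &
  forall p (g : 'rV[R]_n -> R), measurable_fun setT g -> (forall x, 0 <= g x) ->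
  (forall r x, 0 < r -> g (r *: x) = r ^+ p * g x) ->
  (\sum_(e <- signs n) (sign_weight th e)%:E * \int[lebesgue_rV n]_y
     (g (orth_proj th (emul e y)) * pos_density y)%:E =
   c%:E * ((m + p)`!%:R%:E * \int[lebesgue_rV m]_v
     (g (v *m U) * (gauge v <= 1)%R%:R)%:E))%E].
Proof.
have [c c0 cE] := projection_formula th1 basisU; exists c => //.
have mu0 : (0 <= lebesgue_rV m gauge_ball)%E by exact: measure_ge0.
have volE : (weight_sum%:E = c%:E * (m`!%:R%:E * lebesgue_rV m gauge_ball))%E.
  have := cE 0%N (fun=> 1) (measurable_cst _) (fun=> ler01).
  rewrite addn0 => /(_ (fun _ _ _ => esym (mul1r _))).
  rewrite (_ : \int[lebesgue_rV m]_v _ = lebesgue_rV m gauge_ball)%E; last first.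
    transitivity (\int[lebesgue_rV m]_v (\1_gauge_ball v)%:E)%E.
      by apply: eq_integral => v _; rewrite mul1r indicE mem_setE.
    by rewrite integral_indic ?setIT//; exact: measurable_gauge_le1.
  move=> <-; rewrite -sumEFin; apply: eq_bigr => e _.
  under eq_integral do rewrite mul1r.
  by rewrite integral_pos_density mule1.
have W0 := weight_sum_gt0.
have f0 : 0 < m`!%:R :> R by rewrite ltr0n fact_gt0.
move: mu0 volE; case E : (lebesgue_rV m gauge_ball) => [k| |]// k0.
- rewrite -!EFinM => -[WE]; exists k => //.
  move: W0; rewrite WE pmulr_rgt0// pmulr_rgt0//.
- by rewrite gt0_muley ?lte_fin// gt0_muley ?lte_fin//.
Qed.

Lemma integral_uniform (k : R) (g : 'rV[R]_n -> R) : 0 < k ->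
  lebesgue_rV m gauge_ball = k%:E ->
  measurable_fun setT g -> (forall x, 0 <= g x) ->
  (k%:E * \int[P]_w (g (X w))%:E =
   \int[lebesgue_rV m]_v (g (v *m U) * (gauge v <= 1)%R%:R)%:E)%E.
Proof.
move=> k0 volE mg g0.
have mEg : measurable_fun setT (fun x => (g x)%:E) by exact/measurable_EFinP.
have mU : measurable_fun setT (fun v : 'rV[R]_m => v *m U) by exact: measurable_mulmx.
have Eg0 x : (0 <= (g x)%:E)%E by rewrite lee_fin.
rewrite -(@ge0_integral_distribution _ _ _ _ _ P X (fun x => (g x)%:E))//.
pose phi (v : 'rV[R]_m) := v *m U.
have mphi : measurable_fun setT phi := mU.
have ik0 : 0 <= k^-1 by rewrite invr_ge0 ltW.
pose nu := mscale (NngNum ik0)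
  (pushforward (mrestr (lebesgue_rV m) measurable_gauge_le1) phi).
transitivity (k%:E * \int[nu mphi]_x (g x)%:E)%E.
  congr (_ * _)%E; apply: eq_measure_integral => A mA _.
  apply: etrans (unifX mA) _.
  rewrite /subspace_lebesgue /pushforward preimage_setI -gauge_le1E volE.
  by rewrite inver gt_eqF// muleC.
rewrite ge0_integral_mscale//= muleA -EFinM divff ?gt_eqF// mul1e.
rewrite (ge0_integral_pushforward mphi)// preimage_setT.
have mc : measurable_fun setT ((fun x => (g x)%:E) \o phi) := measurableT_comp mEg mphi.
rewrite ge0_integral_mrestr//; last by move=> v; exact: Eg0.
rewrite integral_mkcond; apply: eq_integral => v _.
rewrite patchE (_ : (v \in _) = (gauge v <= 1)); last by apply/idP/idP; rewrite inE.
by case: ifP => _; rewrite ?mulr1 ?mulr0.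
Qed.

(** Both the volume and the constant of the projection formula drop out, since they enter only
    through the total weight. *)
Lemma uniform_moment p (g : 'rV[R]_n -> R) :
  measurable_fun setT g -> (forall x, 0 <= g x) ->
  (forall r x, 0 < r -> g (r *: x) = r ^+ p * g x) ->
  ((weight_sum * (m + p)`!%:R)%:E * \int[P]_w (g (X w))%:E =
   m`!%:R%:E * \sum_(e <- signs n) (sign_weight th e)%:E * \int[lebesgue_rV n]_y
     (g (orth_proj th (emul e y)) * pos_density y)%:E)%E.
Proof.
move=> mg g0 gZ.
have [c c0 [k k0 [volE WE momE]]] := projection_volume.
rewrite (momE p)// -(integral_uniform k0 volE)// !muleA -!EFinM WE.
by congr (_%:E * _)%E; ring.
Qed.

Lemma dotv_row_basis (v : 'rV[R]_m) i : dotv (v *m U) (row i U) = v ord0 i.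
Proof.
have [UU _] := basisU.
rewrite dotvE rowE trmx_mul mulmxA -[v *m U *m U^T]mulmxA UU mulmx1.
by rewrite trmx_delta -colE mxE.
Qed.

Lemma dotv_basis_sqr (v : 'rV[R]_m) :
  dotv (v *m U) (v *m U) = \sum_i dotv (v *m U) (row i U) ^+ 2.
Proof.
have [UU _] := basisU.
rewrite dotvE trmx_mul mulmxA -[v *m U *m U^T]mulmxA UU mulmx1 -dotvE.
by apply: eq_bigr => i _; rewrite dotv_row_basis expr2.
Qed.

Lemma integral_norm_le_lambda :
  (\int[P]_w (dotv (X w) (X w))%:E <= m%:R%:E * lambda_sqr P (hyperplane th) X)%E.
Proof.
have [c c0 [k k0 [volE WE momE]]] := projection_volume.
have md (a : 'rV[R]_n) := measurable_dotv a.
have mdd : measurable_fun setT (fun x : 'rV[R]_n => dotv x x).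
  by apply: measurable_sum => i; apply: measurable_funM; exact: measurable_coord.
(* X lies in H only almost surely, so the expansion in the basis is made after passing to R^m, where
   the vector is [v *m U]. *)
have -> : (\int[P]_w (dotv (X w) (X w))%:E =
    \sum_(i < m) \int[P]_w (dotv (X w) (row i U) ^+ 2)%:E)%E.
  have kfin : k%:E != 0%E by rewrite eqe gt_eqF.
  have inj (a b : \bar R) : (k%:E * a = k%:E * b -> a = b)%E.
    move=> /(congr1 (fun z => k^-1%:E * z)%E).
    by rewrite !muleA -EFinM mulVf ?gt_eqF// !mul1e.
  apply: inj; rewrite (integral_uniform (g := fun x => dotv x x) k0 volE)//; last first.
    by move=> x; exact: dotvv_ge0.
  rewrite ge0_sume_distrr; last by move=> i _; apply: integral_ge0 => w _; rewrite lee_fin sqr_ge0.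
  under [RHS]eq_bigr => i _.
    rewrite (integral_uniform (g := fun x => dotv x (row i U) ^+ 2) k0 volE)//; last 2 first.
    - exact: measurable_funX.
    - by move=> x; exact: sqr_ge0.
    over.
  rewrite -ge0_integral_sum//.
  - by apply: eq_integral => v _; rewrite sumEFin dotv_basis_sqr mulr_suml.
  - move=> i; apply/measurable_EFinP/measurable_funM.
      by apply: measurable_funX; apply: (measurableT_comp (md _)); exact: measurable_mulmx.
    rewrite (_ : (fun v => _) = (\1_gauge_ball : _ -> R)).
      by apply: measurable_indic; exact: measurable_gauge_le1.
    by apply/funext => v; rewrite indicE; congr (nat_of_bool _)%:R; apply/idP/idP; rewrite inE.
  - by move=> i v _; rewrite lee_fin mulr_ge0 ?sqr_ge0.
have -> : (m%:R%:E * lambda_sqr P (hyperplane th) X =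
    \sum_(i < m) lambda_sqr P (hyperplane th) X)%E.
  by rewrite sumr_const card_ord mule_natl.
apply: lee_sum => i _; apply: ereal_sup_ubound; exists (row i U).
  split; last first.
    rewrite /enorm; have := dotv_row_basis (delta_mx 0 i) i.
    by rewrite -rowE => ->; rewrite mxE !eqxx sqrtr1.
  rewrite rowE; exact: (dotv_basis basisU).
by rewrite unlock.
Qed.

End uniform_on_projection.

(* N is the dimension, W the total weight of the q = 2 ^ N sign vectors, and e2, e4
   are the expectations of |X|^2, |X|^4. *)
Lemma variance_bound (R : realType) (N W q T2 e2 e4 : R) :
  2 <= N -> 0 < W -> 5 / 18 * q <= W ->
  (N - 1) * W <= T2 -> (N *+ 2 - 1) * W - 2 * q <= T2 ->
  W * (N * (N + 1)) * e2 = T2 ->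
  W * (N * (N + 1) * (N + 2) * (N + 3)) * e4 <= W * (4 * N ^+ 2 + 20 * N) + 216 * q ->
  e4 - e2 ^+ 2 <= 1000 * (e2 / (N - 1)) * e2.
Proof.
move=> N2 W0 qW T2a T2b e2E e4E.
(* This is [T2 / W]. Below, [q / W <= 18 / 5] gives 41/5 = 1 + 2 * 18/5, and 778 is 216 * 18/5
   rounded up. *)
pose t := N * (N + 1) * e2.
have ta : N - 1 <= t.
  by rewrite -(ler_pM2r W0) (le_trans T2a)// -e2E /t le_eqVlt; apply/orP; left; apply/eqP; ring.
have tb : 2 * N - 41 / 5 <= t.
  rewrite -(ler_pM2r W0) (_ : t * W = T2); last by rewrite -e2E /t; ring.
  apply: le_trans T2b; lra.
have e4b : N * (N + 1) * (N + 2) * (N + 3) * e4 <= 4 * N ^+ 2 + 20 * N + 778.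
  rewrite -(ler_pM2l W0) mulrA (le_trans e4E)//; lra.
have D0 : 0 < N * (N + 1) by rewrite mulr_gt0; lra.
have e40 : (N * (N + 1)) ^+ 2 * e4 <= 4 * N ^+ 2 + 20 * N + 778.
  (* Replacing (N + 2) (N + 3) by the smaller N (N + 1) lowers the left-hand side only when [e4] is
     positive. *)
  have [e4n|e4p] := leP e4 0.
    apply: (@le_trans _ _ 0); first by rewrite pmulr_rle0// exprn_gt0.
    by have := sqr_ge0 N; lra.
  apply: le_trans e4b; rewrite ler_pM2r// expr2 -[leRHS]mulrA ler_pM2l//.
  nra.
have N1 : 0 < N - 1 by lra.
have t2 : 4 * N ^+ 2 - 164 / 5 * N <= t ^+ 2.
  have [N8|N8] := leP (2 * N - 41 / 5) 0; first by nra.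
  have : (2 * N - 41 / 5) ^+ 2 <= t ^+ 2 by rewrite ler_pXn2r// nnegrE ltW//; exact: lt_le_trans tb.
  lra.
have t3 : N - 1 <= t ^+ 2 / (N - 1).
  by rewrite ler_pdivlMr// -expr2 ler_pXn2r// nnegrE ltW//; exact: lt_le_trans ta.
rewrite -(ler_pM2l (exprn_gt0 2 D0)).
have -> : (N * (N + 1)) ^+ 2 * (1000 * (e2 / (N - 1)) * e2) = 1000 * (t ^+ 2 / (N - 1)).
  by rewrite /t; field; rewrite gt_eqF.
have -> : (N * (N + 1)) ^+ 2 * (e4 - e2 ^+ 2) = (N * (N + 1)) ^+ 2 * e4 - t ^+ 2.
  by rewrite /t; ring.
(* What remains is 264/5 N + 778 <= 1000 (N - 1); at N = 2 the left-hand side is 883.6. *)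
lra.
Qed.

Lemma enorm_sqr (R : realType) n (x : 'rV[R]_n) : enorm x ^+ 2 = dotv x x.
Proof. by rewrite /enorm sqr_sqrtr// dotvv_ge0. Qed.

Lemma variance_integral d (T : measurableType d) (R : realType) (P : probability T R)
    (Y : T -> R) (e2 e4 : R) : measurable_fun setT Y -> (forall w, 0 <= Y w) ->
  (\int[P]_w (Y w)%:E = e2%:E)%E -> (\int[P]_w (Y w ^+ 2)%:E = e4%:E)%E ->
  ('V_P[Y] = (e4 - e2 ^+ 2)%:E)%E.
Proof.
move=> mY Y0 E2 E4.
have L (Z : T -> R) r : measurable_fun setT Z -> (forall w, 0 <= Z w) ->
    (\int[P]_w (Z w)%:E = r%:E)%E -> Z \in Lfun P 1%E.
  move=> mZ Z0 EZ; apply/Lfun1_integrable/integrableP; split.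
    exact/measurable_EFinP.
  under eq_integral do rewrite gee0_abs ?lee_fin//.
  by rewrite EZ ltry.
have L2 : (Y * Y)%R \in Lfun P 1%E.
  by apply: (L (fun w => Y w ^+ 2) e4) => //; [exact: measurable_funX|move=> w; exact: sqr_ge0].
rewrite /variance covarianceE//; try exact: (L Y e2).
rewrite unlock E2 -EFinM -expr2 EFinB; congr (_ - _)%E.
by rewrite -E4; apply: eq_integral => w _; rewrite expr2.
Qed.

Theorem theorem3p4 (R : realType) :
  exists2 C : R, 0 < C &
    forall (n : nat) (theta : 'rV[R]_n),
      (2 <= n)%N -> enorm theta = 1 ->
    forall (d : measure_display) (T : measurableType d) (P : probability T R)
      (X : {RV P >-> 'rV[R]_n}),
      uniform_in_hyperplane P (hyperplane theta)
        (orth_proj theta @` l1_ball n) X ->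
      ('V_P[fun w => (enorm (X w) ^+ 2)%R] <=
        C%:E * lambda_sqr P (hyperplane theta) X
             * 'E_P[fun w => (enorm (X w) ^+ 2)%R])%E.
Proof.
exists 1000; first by rewrite ltr0n.
case=> [|m] th n2; first by [].
move=> e1 d T P X [U basisU unifX].
have th1 : dotv th th = 1 by rewrite -enorm_sqr e1 expr1n.
rewrite (_ : (fun w => enorm (X w) ^+ 2) = (fun w => dotv (X w) (X w))); last first.
  by apply/funext => w; rewrite enorm_sqr.
set W := \sum_(e <- signs m.+1) sign_weight th e.
pose N : R := m.+1%:R; pose q : R := 2 ^+ m.+1.
have W0 : 0 < W by exact: weight_sum_gt0.
have fp : 0 < m`!%:R :> R by rewrite ltr0n fact_gt0.
have N1E : m.+2%:R = N + 1 by rewrite -natr1.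
have N2E : m.+3%:R = N + 2 by rewrite /N -natrD addn2.
have N3E : m.+4%:R = N + 3 by rewrite /N -natrD addn3.
have mdd : measurable_fun setT (fun x : 'rV[R]_m.+1 => dotv x x).
  by apply: measurable_sum => i; apply: measurable_funM; exact: measurable_coord.
have ddZ r (x : 'rV[R]_m.+1) : dotv (r *: x) (r *: x) = r ^+ 2 * dotv x x.
  by rewrite dotvZl dotvC dotvZl mulrA expr2.
have ddZ4 r (x : 'rV[R]_m.+1) :
    dotv (r *: x) (r *: x) ^+ 2 = r ^+ 4 * dotv x x ^+ 2.
  by rewrite ddZ exprMn -exprM.
have mdX : measurable_fun setT (fun w => dotv (X w) (X w)).
  by apply: (measurableT_comp mdd); exact: measurable_funPT.
pose T2 := \sum_(e <- signs m.+1) sign_weight th e * (N *+ 2 - 1 - dotv e th ^+ 2).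
have mom2 := uniform_moment (p := 2) th1 basisU unifX mdd (@dotvv_ge0 _ _) (fun r x _ => ddZ r x).
have mom4 := uniform_moment (p := 4) (g := fun x => dotv x x ^+ 2) th1 basisU unifX
  (measurable_funX 2 mdd) (fun x => sqr_ge0 _)
  (fun r x _ => ddZ4 r x).
have {}mom2 : ((W * (N * (N + 1)))%:E * \int[P]_w (dotv (X w) (X w))%:E = T2%:E)%E.
  have sumE : (\sum_(e <- signs m.+1) (sign_weight th e)%:E * \int[lebesgue_rV m.+1]_y
      (proj_sqr th (emul e y) * pos_density y)%:E = T2%:E)%E.
    rewrite -sumEFin big_seq [RHS]big_seq; apply: eq_bigr => e es.
    by rewrite integral_proj_sqr// -EFinM.
  move: mom2; rewrite sumE => /(congr1 (fun z => (m`!%:R^-1)%:E * z)%E).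
  rewrite !muleA -!EFinM mulVf ?gt_eqF// mul1r => <-; congr (_%:E * _)%E.
  by rewrite addn2 !factS !natrM N1E -/N -/W; field; rewrite gt_eqF.
have {}mom4 : ((W * (N * (N + 1) * (N + 2) * (N + 3)))%:E *
    \int[P]_w (dotv (X w) (X w) ^+ 2)%:E <=
    (W * (4 * N ^+ 2 + 20 * N) + 216 * q)%:E)%E.
  apply: le_trans (sum_weight_proj_quartic_integral_le th1).
  rewrite -(@lee_pmul2l _ m`!%:R%:E) ?lte_fin// -mom4 muleA -EFinM.
  rewrite le_eqVlt; apply/orP; left; apply/eqP; congr (_%:E * _)%E.
  rewrite addn4 !factS !natrM N1E N2E N3E -/N -/W; ring.
have N2 : 2 <= N by rewrite ler_nat.
have K2 : 0 < W * (N * (N + 1)) by rewrite !mulr_gt0//; lra.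
have K4 : 0 < W * (N * (N + 1) * (N + 2) * (N + 3)) by rewrite !mulr_gt0//; lra.
have I2 : (0 <= \int[P]_w (dotv (X w) (X w))%:E)%E.
  by apply: integral_ge0 => w _; rewrite lee_fin dotvv_ge0.
have I4 : (0 <= \int[P]_w (dotv (X w) (X w) ^+ 2)%:E)%E.
  by apply: integral_ge0 => w _; rewrite lee_fin sqr_ge0.
have lam := integral_norm_le_lambda th1 basisU unifX.
have -> : ('E_P[fun w => dotv (X w) (X w)] = \int[P]_w (dotv (X w) (X w))%:E)%E.
  by rewrite unlock.
(* An infinite moment would contradict the finite right-hand side of [mom2]; the fourth moment is
   treated alike. *)
case E2 : (\int[P]_w (dotv (X w) (X w))%:E)%E I2 mom2 lam => [e2| |]//; last first.
  by rewrite gt0_muley ?lte_fin.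
move=> e20 [e2E] lam.
case E4 : (\int[P]_w (dotv (X w) (X w) ^+ 2)%:E)%E I4 mom4 => [e4| |]//; last first.
  by rewrite gt0_muley ?lte_fin// leye_eq.
move=> e40; rewrite -EFinM lee_fin => e4E.
rewrite (variance_integral mdX (fun w => dotvv_ge0 (X w)) E2 E4).
have m0 : 0 < N - 1 by lra.
have lam' : ((e2 / (N - 1))%:E <= lambda_sqr P (hyperplane th) X)%E.
  have NE : N - 1 = m%:R by rewrite /N -natr1 addrK.
  rewrite NE in m0 *; rewrite mulrC EFinM.
  apply: le_trans (lee_wpmul2l _ lam) _; first by rewrite lee_fin invr_ge0 ltW.
  by rewrite muleA -EFinM mulVf ?mul1e// gt_eqF.
apply: (@le_trans _ _ (1000 * (e2 / (N - 1)) * e2)%:E).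
  rewrite lee_fin; apply: (@variance_bound _ N W q T2) => //.
  - exact: sum_sign_weight_ge.
  (* As <e, th>^2 <= N, each factor 2 N - 1 - <e, th>^2 is at least N - 1. *)
  - rewrite /T2 mulr_sumr [leLHS]big_seq [leRHS]big_seq; apply: ler_sum => e es.
    rewrite mulrC ler_wpM2l ?sign_weight_ge0//.
    have := signs_dot_sqr_le th1 es; rewrite -/N; lra.
  - have -> : T2 = (N *+ 2 - 1) * W -
        \sum_(e <- signs m.+1) sign_weight th e * dotv e th ^+ 2.
      by rewrite /T2 mulr_sumr -sumrB; apply: eq_bigr => e _; ring.
    by rewrite lerD2l lerN2; exact: sum_sign_weight_sqr_le.
have C0 : (0 <= (1000 : R)%:E)%E by rewrite lee_fin ler0n.
move: (1000 : R) C0 => C C0.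
by rewrite EFinM; apply: lee_wpmul2r => //; rewrite EFinM; exact: lee_wpmul2l.
Qed.
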